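(* Let $n\ge3$, $k\in\mathbb N$ and $m\in\{2,3,\dots,n-1\}$, and consider the basis functions $\psi_{\mathbf j}$ ($\mathbf j$ $k$-allowable) of $\mathcal M_k^q(\mathbb R^n)$. Then there exist scalars $A_{\mathbf j},B_{\mathbf j},C_{\mathbf j}$ such that for every $k$-allowable $\mathbf j$ $$\Gamma_{\{m,m+1\}}^q\psi_{\mathbf j}=B_{\mathbf j}\,\psi_{\mathbf j-\mathbf h_m}+A_{\mathbf j}\,\psi_{\mathbf j}+C_{\mathbf j}\,\psi_{\mathbf j+\mathbf h_m}.$$ The constant $B_{\mathbf j}$ is non-zero if the vectors $\mathbf j$ and $\mathbf j-\mathbf h_m$ are both $k$-allowable, and $C_{\mathbf j}$ is non-zero if $\mathbf j$ and $\mathbf j+\mathbf h_m$ are both $k$-allowable.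
   Context: Let $q$ be a nonzero complex number with $|q|\neq1$ (fix a logarithm of $q$ to define $q^a$ for real $a$). Notation: $[a]_q=\frac{q^a-q^{-a}}{q-q^{-1}}$, $\{X,Y\}=XY+YX$, $[j]=\{1,\dots,j\}$. A vector $\mathbf j=(j_1,\dots,j_{n-1})\in\mathbb Z^{n-1}$ is $k$-allowable if all entries are non-negative and add up to $k$. $\mathbf h_m\in\mathbb Z^{n-1}$ has entry $1$ at position $m-1$, entry $-1$ at position $m$, and $0$ elsewhere. By convention $\psi_{\mathbf j'}=0$ if $\mathbf j'$ is not $k$-allowable. **The algebra.** $\mathfrak{osp}_q(1|2)$ is the unital associative $\mathbb C$-algebra with generators $A_+,A_-,K,K^{-1},P$ and relations $KA_{\pm}K^{-1}=q^{\pm1/2}A_\pm$, $\{A_+,A_-\}=\frac{K^2-K^{-2}}{q^{1/2}-q^{-1/2}}$, $\{P,A_\pm\}=0$, $[P,K]=[P,K^{-1}]=0$, $KK^{-1}=K^{-1}K=1$, $P^2=1$. Tensor powers carry the standard (ungraded) componentwise product. $\Delta$ is the algebra morphism with $\Delta(A_\pm)=A_\pm\otimes KP+K^{-1}\otimes A_\pm$, $\Delta(K)=K\otimes K$, $\Delta(P)=P\otimes P$. The Casimir element is $\Gamma^q=\left(-A_+A_-+\frac{q^{-1/2}K^2-q^{1/2}K^{-2}}{q-q^{-1}}\right)P$. Put $\Gamma^q_{\{m,m+1\}}=1^{\otimes(m-1)}\otimes\Delta(\Gamma^q)\otimes1^{\otimes(n-m-1)}\in\mathfrak{osp}_q(1|2)^{\otimes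 n}$. **Realization.** $\mathcal P(\mathbb R^j)$ is the space of complex-valued polynomials in $x_1,\dots,x_j$ and $\mathcal P_k(\mathbb R^j)$ its homogeneous part of degree $k$. Fix $\mu_1,\dots,\mu_n>0$, $\gamma_i=\mu_i+\frac12$, $\gamma_{[j]}=\sum_{i\le j}\gamma_i$. Let $r_i$ be the substitution $x_i\mapsto-x_i$ and $T_{q,i}^{s}$ the substitution $x_i\mapsto q^sx_i$, and $$D_i^q=\frac{q^{\mu_i}}{q-q^{-1}}\,\frac{T_{q,i}-r_i}{x_i}-\frac{q^{-\mu_i}}{q-q^{-1}}\,\frac{T_{q,i}^{-1}-r_i}{x_i}.$$ $\mathfrak{osp}_q(1|2)^{\otimes n}$ acts on $\mathcal P(\mathbb R^n)$ by letting, in the $i$-th tensor factor, $A_+\mapsto x_i$, $A_-\mapsto D_i^q$, $K\mapsto q^{\gamma_i/2}T_{q,i}^{1/2}$, $P\mapsto r_i$; $\Gamma^q_{\{m,m+1\}}$ also denotes the resulting operator. **Monogenics and basis.** For $1\le j\le n$, $$D_{[j]}^q=\sum_{i=1}^jD_i^qR_{[j],i}^q,\quad X_{[j]}^q=\sum_{i=1}^jx_iR_{[j],i}^q,\quad R^q_{[j],i}=\Big(\prod_{l<i}q^{-\gamma_l/2}T_{q,l}^{-1/2}\Big)\Big(\prod_{i<l\le j}q^{\gamma_l/2}T_{q,l}^{1/2}r_l\Big)\Big(\prod_{j<l\le n}r_l\Big),$$ and $\mathcal M_k^q(\mathbb R^j)=\ker(D_{[j]}^q)\cap\mathcal P_k(\mathbb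 R^j)$. For $2\le j\le n$ the map $\mathbf{CK}_{x_j}^{\mu_j}:\mathcal P_k(\mathbb R^{j-1})\to\mathcal M_k^q(\mathbb R^j)$ is, for each $k$, $$\mathbf{CK}_{x_j}^{\mu_j}=\sum_{\alpha=0}^k\frac{(-1)^{\alpha(\alpha+1)/2}q^{\frac{\alpha}{2}(\gamma_{[j]}+k-1)}}{[\mu_j,\alpha;q][\mu_j,\alpha-1;q]\cdots[\mu_j,1;q]}\,x_j^\alpha\left(D_{[j-1]}^q\right)^\alpha,\qquad[\mu_j,m;q]=[\mu_j+m]_q-(-1)^m[\mu_j]_q.$$ For $\mathbf j=(j_1,\dots,j_{n-1})\in\mathbb N^{n-1}$, $$\psi_{\mathbf j}=\mathbf{CK}_{x_n}^{\mu_n}\Big[(X_{[n-1]}^q)^{j_{n-1}}\mathbf{CK}_{x_{n-1}}^{\mu_{n-1}}\Big[\cdots\Big[(X_{[2]}^q)^{j_2}\mathbf{CK}_{x_2}^{\mu_2}(x_1^{j_1})\Big]\cdots\Big]\Big].$$ The $\psi_{\mathbf j}$ with $\mathbf j$ $k$-allowable form a basis of $\mathcal M_k^q(\mathbb R^n)$. *)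

(* Defs.v *)
From HB Require Import structures.
From mathcomp Require Import all_boot all_order all_algebra.
From mathcomp Require Import reals.
From mathcomp Require sequences exp trigo.
From mathcomp.real_closed Require Import complex.
From mathcomp Require mpoly.
From mathcomp Require Import ring.

Set Implicit Arguments.
Unset Strict Implicit.
Unset Printing Implicit Defensive.

Import Order.TTheory GRing.Theory Num.Theory.

(* The notations of MathComp-Analysis clash with those of mpoly, hence the
   module confining them. *)
Module ComplexExp.
Import sequences exp trigo.
Local Open Scope ring_scope.
Local Open Scope complex_scope.

Definition cexp (R : realType) (z : R[i]) : R[i] :=
  let: x +i* y := z in (expR x)%:C * (cos y +i* sin y).

Lemma cexpD (R : realType) (z w : R[i]) : cexp (z + w) = cexp z * cexp w.
Proof.
case: z w => [a b] [c d]; rewrite /cexp /= expRD cosD sinD.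
by apply/eqP; rewrite eq_complex /=; apply/andP; split; apply/eqP; ring.
Qed.

Lemma cexp0 (R : realType) : cexp (0 : R[i]) = 1.
Proof. by rewrite /cexp /= expR0 cos0 sin0 mul1r. Qed.

End ComplexExp.
Notation cexp := ComplexExp.cexp.

From mathcomp Require Import mpoly.

Local Open Scope ring_scope.
Local Open Scope complex_scope.

Section Presentation.
Variable F : comNzRingType.

(* Elements of an associative unital F-algebra presented by generators X are
   represented by expressions; [pres_eq rel] below is equality in the algebra
   presented by X and the relations rel. *)
Inductive expr (X : Type) : Type :=
| Gen of X
| Scal of F
| Add of expr X & expr X
| Mul of expr X & expr X.

Definition Sub X (a b : expr X) := Add a (Mul (Scal X (-1)) b).

Fixpoint subst X Y (f : X -> expr Y) (t : expr X) : expr Y :=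
  match t with
  | Gen x => f x
  | Scal c => Scal Y c
  | Add a b => Add (subst f a) (subst f b)
  | Mul a b => Mul (subst f a) (subst f b)
  end.

Inductive pres_eq X (rel : expr X -> expr X -> Prop) :
  expr X -> expr X -> Prop :=
| pres_rel a b : rel a b -> pres_eq rel a b
| pres_refl a : pres_eq rel a a
| pres_sym a b : pres_eq rel a b -> pres_eq rel b a
| pres_trans a b c : pres_eq rel a b -> pres_eq rel b c -> pres_eq rel a c
| pres_add a a' b b' :
    pres_eq rel a a' -> pres_eq rel b b' -> pres_eq rel (Add a b) (Add a' b')
| pres_mul a a' b b' :
    pres_eq rel a a' -> pres_eq rel b b' -> pres_eq rel (Mul a b) (Mul a' b')
| pres_addA a b c : pres_eq rel (Add a (Add b c)) (Add (Add a b) c)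
| pres_addC a b : pres_eq rel (Add a b) (Add b a)
| pres_add0 a : pres_eq rel (Add (Scal X 0) a) a
| pres_mulA a b c : pres_eq rel (Mul a (Mul b c)) (Mul (Mul a b) c)
| pres_mulDl a b c : pres_eq rel (Mul (Add a b) c) (Add (Mul a c) (Mul b c))
| pres_mulDr a b c : pres_eq rel (Mul a (Add b c)) (Add (Mul a b) (Mul a c))
| pres_scalD c d : pres_eq rel (Add (Scal X c) (Scal X d)) (Scal X (c + d))
| pres_scalM c d : pres_eq rel (Mul (Scal X c) (Scal X d)) (Scal X (c * d))
| pres_scal0 a : pres_eq rel (Mul (Scal X 0) a) (Scal X 0)
| pres_scal1 a : pres_eq rel (Mul (Scal X 1) a) a
| pres_scalC c a : pres_eq rel (Mul (Scal X c) a) (Mul a (Scal X c)).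

(* The action on a module V determined by an action of the generators. *)
Fixpoint act X (V : lmodType F) (rho : X -> V -> V) (t : expr X) (v : V) : V :=
  match t with
  | Gen x => rho x v
  | Scal c => c *: v
  | Add a b => act rho a v + act rho b v
  | Mul a b => act rho a (act rho b v)
  end.

Lemma act_linear X (V : lmodType F) (rho : X -> V -> V) t :
  (forall x c u v, rho x (c *: u + v) = c *: rho x u + rho x v) ->
  forall c u v, act rho t (c *: u + v) = c *: act rho t u + act rho t v.
Proof.
move=> lin; elim: t => [x|d|a IHa b IHb|a IHa b IHb] c u v /=; first exact: lin.
- by rewrite scalerDr !scalerA mulrC.
- by rewrite IHa IHb scalerDr addrACA.
- by rewrite IHb IHa.
Qed.

Lemma act_pres_eq X (V : lmodType F) (rho : X -> V -> V) rel :
  (forall x c u v, rho x (c *: u + v) = c *: rho x u + rho x v) ->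
  (forall a b, rel a b -> act rho a =1 act rho b) ->
  forall a b, pres_eq rel a b -> act rho a =1 act rho b.
Proof.
move=> lin sound a b; have lA t := act_linear t lin.
have actD t u v : act rho t (u + v) = act rho t u + act rho t v.
  by rewrite -[u]scale1r lA !scale1r.
have act0 t : act rho t 0 = 0.
  by apply: (addrI (act rho t 0)); rewrite -actD !addr0.
elim=> {a b} /=.
- by move=> a b /sound.
- by [].
- by move=> a b _ IH v; rewrite IH.
- by move=> a b c _ IH1 _ IH2 v; rewrite IH1.
- by move=> a a' b b' _ IH1 _ IH2 v; rewrite IH1 IH2.
- by move=> a a' b b' _ IH1 _ IH2 v; rewrite IH1 IH2.
- by move=> a b c v; rewrite addrA.
- by move=> a b v; rewrite addrC.
- by move=> a v; rewrite scale0r add0r.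
- by [].
- by [].
- by move=> a b c v; rewrite actD.
- by move=> c d v; rewrite scalerDl.
- by move=> c d v; rewrite scalerA.
- by move=> a v; rewrite !scale0r.
- by move=> a v; rewrite scale1r.
- by move=> c a v; rewrite -[c *: v]addr0 lA act0 addr0.
Qed.

End Presentation.

(* For a logarithm ell of q, this is the power q^a. *)
Definition cpow (R : realType) (ell : R[i]) (a : R) : R[i] :=
  cexp (a%:C * ell).

Lemma cpowD (R : realType) (ell : R[i]) a b :
  cpow ell (a + b) = cpow ell a * cpow ell b.
Proof. by rewrite /cpow -ComplexExp.cexpD -mulrDl rmorphD. Qed.

Lemma cpow1 (R : realType) (ell : R[i]) : cpow ell 1 = cexp ell.
Proof. by rewrite /cpow mul1r. Qed.

(* Below, qpow a stands for q^a; the field F is C and the field R is that of the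
   real numbers in the intended instance. *)
Section Osp.
Variables (R : realFieldType) (F : fieldType) (q : F) (qpow : R -> F).

Variant osp_gen := genAp | genAm | genK | genKinv | genP.

Local Notation "[ g ]" := (Gen _ g) (format "[ g ]").
Local Notation "a ** b" := (Mul a b) (at level 40, left associativity).
Local Notation "a ++ b" := (Add a b).
Local Notation scal c := (Scal _ c).

Inductive osp_rel : expr F osp_gen -> expr F osp_gen -> Prop :=
| osp_KAp : osp_rel ([genK] ** [genAp] ** [genKinv])
                    (scal (qpow 2^-1) ** [genAp])
| osp_KAm : osp_rel ([genK] ** [genAm] ** [genKinv])
                    (scal (qpow (- 2^-1)) ** [genAm])
| osp_ApAm : osp_rel ([genAp] ** [genAm] ++ [genAm] ** [genAp])
    (scal (qpow 2^-1 - qpow (- 2^-1))^-1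
       ** Sub ([genK] ** [genK]) ([genKinv] ** [genKinv]))
| osp_PAp : osp_rel ([genP] ** [genAp] ++ [genAp] ** [genP]) (scal 0)
| osp_PAm : osp_rel ([genP] ** [genAm] ++ [genAm] ** [genP]) (scal 0)
| osp_PK : osp_rel ([genP] ** [genK]) ([genK] ** [genP])
| osp_PKinv : osp_rel ([genP] ** [genKinv]) ([genKinv] ** [genP])
| osp_KKinv : osp_rel ([genK] ** [genKinv]) (scal 1)
| osp_KinvK : osp_rel ([genKinv] ** [genK]) (scal 1)
| osp_PP : osp_rel ([genP] ** [genP]) (scal 1).

(* In the n-th tensor power, the generator (i, g) stands for
   1 ⊗ ... ⊗ g ⊗ ... ⊗ 1 with g in the i-th factor (counted from 0); for the
   componentwise product, generators in distinct factors commute. *)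
Inductive osp_tensor_rel n :
  expr F ('I_n * osp_gen) -> expr F ('I_n * osp_gen) -> Prop :=
| osp_factor i a b : osp_rel a b ->
    osp_tensor_rel (subst (fun g => [(i, g)]) a) (subst (fun g => [(i, g)]) b)
| osp_comm i j g h : i != j ->
    osp_tensor_rel ([(i, g)] ** [(j, h)]) ([(j, h)] ** [(i, g)]).

Definition osp_eq := pres_eq osp_rel.
Definition osp_tensor_eq n := pres_eq (@osp_tensor_rel n).

Definition casimir : expr F osp_gen :=
  (scal (-1) ** [genAp] ** [genAm]
   ++ Sub (scal (qpow (- 2^-1) / (q - q^-1)) ** ([genK] ** [genK]))
          (scal (qpow 2^-1 / (q - q^-1)) ** ([genKinv] ** [genKinv])))
  ** [genP].

(* The value at K^-1 is forced by the one at K. *)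
Definition coproduct_gen (g : osp_gen) : expr F ('I_2 * osp_gen) :=
  let l g := [(ord0 : 'I_2, g)] in let r g := [(ord_max : 'I_2, g)] in
  match g with
  | genAp => l genAp ** (r genK ** r genP) ++ l genKinv ** r genAp
  | genAm => l genAm ** (r genK ** r genP) ++ l genKinv ** r genAm
  | genK => l genK ** r genK
  | genKinv => l genKinv ** r genKinv
  | genP => l genP ** r genP
  end.

Definition coproduct : expr F osp_gen -> expr F ('I_2 * osp_gen) :=
  subst coproduct_gen.

(* Here the factors are counted from 1: for 1 <= m <= n this is the element
   1^{⊗(m-1)} ⊗ Δ(Γ) ⊗ 1^{⊗(n-m)} of the (n.+1)-st tensor power. *)
Definition casimir_pair n (m : nat) : expr F ('I_n.+1 * osp_gen) :=
  subst (fun sg : 'I_2 * osp_gen => [(inord (m.-1 + sg.1)%N : 'I_n.+1, sg.2)])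
    (coproduct casimir).

End Osp.

(* Locked, because failing conversions would unfold them. *)
HB.lock Definition dilate (F : fieldType) (n : nat) (i : 'I_n) (c : F)
    (p : {mpoly F[n]}) : {mpoly F[n]} :=
  p \mPo [tuple (if l == i then c *: 'X_l else 'X_l) | l < n].

(* Exact division by 'X_i, see [divXK]; monomials free of 'X_i are dropped. *)
HB.lock Definition divX (F : fieldType) (n : nat) (i : 'I_n)
    (p : {mpoly F[n]}) : {mpoly F[n]} :=
  \sum_(m <- msupp p | m i != 0%N) p@_m *: 'X_[m - U_(i)].

(* Polynomials in n.+1 variables; x_{i+1} is 'X_i. For j <= n.+1, P(R^j) is
   viewed inside P(R^{n+1}). *)
Section Realization.
Variables (R : realFieldType) (F : fieldType) (n : nat).
Variables (q : F) (qpow : R -> F) (mu : 'I_n.+1 -> R).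
Local Notation Pol := {mpoly F[n.+1]}.

Definition qbr (a : R) : F := (qpow a - qpow (- a)) / (q - q^-1).
Definition gamma (i : 'I_n.+1) : R := mu i + 2^-1.
Definition gamma_sum (j : nat) : R := \sum_(i < n.+1 | (i < j)%N) gamma i.

Definition Tq (i : 'I_n.+1) (s : R) : Pol -> Pol := dilate i (qpow s).
Definition reflx (i : 'I_n.+1) : Pol -> Pol := dilate i (-1).

Definition Dq (i : 'I_n.+1) (p : Pol) : Pol :=
  (qpow (mu i) / (q - q^-1)) *: divX i (Tq i 1 p - reflx i p)
  - (qpow (- mu i) / (q - q^-1)) *: divX i (Tq i (-1) p - reflx i p).

Definition Kq (i : 'I_n.+1) (p : Pol) : Pol :=
  qpow (gamma i / 2) *: Tq i 2^-1 p.
Definition Kqinv (i : 'I_n.+1) (p : Pol) : Pol :=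
  qpow (- (gamma i / 2)) *: Tq i (- 2^-1) p.

Definition realization (ig : 'I_n.+1 * osp_gen) : Pol -> Pol :=
  let: (i, g) := ig in
  match g with
  | genAp => fun p => 'X_i * p
  | genAm => Dq i
  | genK => Kq i
  | genKinv => Kqinv i
  | genP => reflx i
  end.

(* The operators R_{[j],i}, D_{[j]} and X_{[j]}, with j as in {1, ..., n+1} but
   i counted from 0. All factors of R_{[j],i} commute. *)
Definition Rop (j : nat) (i : 'I_n.+1) : Pol -> Pol :=
  (\big[comp/id]_(l < n.+1 | (l < i)%N) Kqinv l)
  \o (\big[comp/id]_(l < n.+1 | (i < l < j)%N) (Kq l \o reflx l))
  \o (\big[comp/id]_(l < n.+1 | (j <= l)%N) reflx l).

Definition Dsum (j : nat) (p : Pol) : Pol :=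
  \sum_(i < n.+1 | (i < j)%N) Dq i (Rop j i p).
Definition Xsum (j : nat) (p : Pol) : Pol :=
  \sum_(i < n.+1 | (i < j)%N) 'X_i * Rop j i p.

(* [mu_i, l; q] *)
Definition qbr_mu (i : 'I_n.+1) (l : nat) : F :=
  qbr (mu i + l%:R) - (-1) ^+ l * qbr (mu i).

(* CK_{x_j} on homogeneous polynomials of degree k, for 'X_i = x_j, that is
   j = i + 1. *)
Definition CK (i : 'I_n.+1) (k : nat) (p : Pol) : Pol :=
  \sum_(a < k.+1)
    ((-1) ^+ ((a * a.+1)./2)%N * qpow (a%:R / 2 * (gamma_sum i.+1 + k%:R - 1))
       / \prod_(1 <= l < a.+1) qbr_mu i l)
    *: ('X_i ^+ a * iter a (Dsum i) p).

(* CK_{x_{i+2}}[X_{[i+1]}^{j_{i+1}} ... X_{[2]}^{j_2} CK_{x_2}(x_1^{j_1}) ...],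
   where j_{l+1} is [nth 0 j l]. *)
Fixpoint psi_rec (j : seq nat) (i : nat) : Pol :=
  match i with
  | 0%N => CK (inord 1%N) (nth 0%N j 0%N) ('X_ord0 ^+ nth 0%N j 0%N)
  | i'.+1 => CK (inord i'.+2) (\sum_(l < i'.+2) nth 0%N j l)%N
               (iter (nth 0%N j i'.+1) (Xsum i'.+2) (psi_rec j i'))
  end.

Definition allowable (k : nat) (j : 'rV[int]_n) : bool :=
  [forall l, 0 <= j ord0 l] && (\sum_l j ord0 l == k%:Z).

Definition psi (k : nat) (j : 'rV[int]_n) : Pol :=
  if allowable k j then psi_rec [seq `|j ord0 l|%N | l <- enum 'I_n] n.-1 else 0.

(* Entry 1 at position m - 1 and -1 at position m, positions counted from 1. *)
Definition hvec (m : nat) : 'rV[int]_n :=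
  \row_(l < n) if l.+2 == m then 1 else if l.+1 == m then -1 else 0.

Lemma mcoeff_divX i (p : Pol) m : (divX i p)@_m = p@_(m + U_(i)).
Proof.
rewrite unlock raddf_sum /=.
under eq_bigr do rewrite mcoeffZ mcoeffX.
have E (m' : 'X_{1..n.+1}) :
    m' i != 0%N -> ((m' - U_(i))%MM == m) = (m' == (m + U_(i))%MM).
  move=> nz; have le : (U_(i) <= m')%MM by rewrite lep1mP.
  by apply/eqP/eqP => [<-|->]; rewrite ?submK ?addmK.
under eq_bigr => m' nz do rewrite E //.
have nz : (m + U_(i))%MM i != 0%N by rewrite mnmDE mnm1E eqxx addn1.
case: (boolP ((m + U_(i))%MM \in msupp p)) => [in_p|notin].
  rewrite big_mkcond (bigD1_seq _ in_p (msupp_uniq p)) /= nz eqxx mulr1.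
  rewrite big1 ?addr0 // => m' /negPf ->; rewrite mulr0; by case: ifP.
rewrite (memN_msupp_eq0 notin) big_seq_cond big1 // => m' /andP[in_p _].
by case: eqP in_p => [->|_ _]; rewrite ?(negPf notin) ?mulr0.
Qed.

Lemma divX_linear i c (u v : Pol) : divX i (c *: u + v) = c *: divX i u + divX i v.
Proof. by apply/mpolyP => m; rewrite !(mcoeffD, mcoeffZ, mcoeff_divX). Qed.

Lemma dilateX i c (m : 'X_{1..n.+1}) :
  dilate i c 'X_[m] = c ^+ m i *: 'X_[m] :> Pol.
Proof.
rewrite unlock comp_mpolyX.
under eq_bigr => l _ do rewrite tnth_mktuple.
rewrite [X in _ = _ *: X]mpolyXE_id.
rewrite (bigD1 i) //= eqxx exprZn -scalerAl; congr (_ *: _).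
rewrite [RHS](bigD1 i) //; congr (_ * _).
by apply: eq_bigr => l /negPf ->.
Qed.

Lemma dilate_linear i c a (u v : Pol) :
  dilate i c (a *: u + v) = a *: dilate i c u + dilate i c v.
Proof. by rewrite unlock comp_mpolyD comp_mpolyZ. Qed.

Lemma mcoeff_dilate i c (p : Pol) m : (dilate i c p)@_m = c ^+ m i * p@_m.
Proof.
elim/mpolyind: p => [|a m' p _ _ IH].
  by rewrite unlock comp_mpoly0 mcoeff0 mulr0.
rewrite dilate_linear mcoeffD IH mcoeffD !mcoeffZ dilateX mcoeffZ mcoeffX mulrDr.
by congr (_ + _); case: eqP => [->|_]; rewrite ?mulr0 // !mulr1 mulrC.
Qed.

Lemma mcoeff_XM i (p : Pol) (m : 'X_{1..n.+1}) :
  ('X_i * p : Pol)@_m = if m i == 0%N then 0 else p@_(m - U_(i)).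
Proof.
rewrite (mulrC 'X_i p).
case: eqP => [mi0|/eqP nz]; last first.
  have le : (U_(i) <= m)%MM by rewrite lep1mP.
  by rewrite -[in LHS](submK le) addmC mcoeffMX.
elim/mpolyind: p => [|a m' p _ _ IH]; first by rewrite mul0r mcoeff0.
rewrite mulrDl mcoeffD IH addr0 -scalerAl mcoeffZ -mpolyXD mcoeffX.
case: eqP => [E|_]; last by rewrite mulr0.
by move: mi0; rewrite -E mnmDE mnm1E eqxx addn1.
Qed.

(* Hence the divisions by x_i in D_i are exact. *)
Lemma divXK i s (p : Pol) :
  'X_i * divX i (Tq i s p - reflx i p) = Tq i s p - reflx i p.
Proof.
rewrite /Tq /reflx; move: (qpow s) (-1) => c d.
apply/mpolyP => m; rewrite mcoeff_XM; case: eqP => [mi0|/eqP nz].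
  by rewrite mcoeffB (mcoeff_dilate i c) (mcoeff_dilate i d) mi0 !expr0 subrr.
by rewrite mcoeff_divX submK // lep1mP.
Qed.

Lemma mcoeff_Dq i (p : Pol) m :
  (Dq i p)@_m =
   (qpow (mu i) / (q - q^-1) * (qpow 1 ^+ (m i).+1 - (-1) ^+ (m i).+1)
    - qpow (- mu i) / (q - q^-1) * (qpow (-1) ^+ (m i).+1 - (-1) ^+ (m i).+1))
   * p@_(m + U_(i)).
Proof.
rewrite /Dq.
have lin (a b : F) (u v : Pol) : (a *: u - b *: v)@_m = a * u@_m - b * v@_m.
  by rewrite mcoeffB !mcoeffZ.
have dB (c d : F) : (divX i (dilate i c p - dilate i d p))@_m =
    (c ^+ (m i).+1 - d ^+ (m i).+1) * p@_(m + U_(i)).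
  rewrite mcoeff_divX mcoeffB (mcoeff_dilate i c) (mcoeff_dilate i d).
  by rewrite -mulrBl mnmDE mnm1E eqxx addn1.
by rewrite lin (dB (qpow 1) (-1)) (dB (qpow (-1)) (-1)) !mulrA -mulrBl.
Qed.

Lemma mcoeff_Kq i (p : Pol) m :
  (Kq i p)@_m = qpow (gamma i / 2) * qpow 2^-1 ^+ m i * p@_m.
Proof. by rewrite /Kq mcoeffZ mcoeff_dilate mulrA. Qed.

Lemma mcoeff_Kqinv i (p : Pol) m :
  (Kqinv i p)@_m = qpow (- (gamma i / 2)) * qpow (- 2^-1) ^+ m i * p@_m.
Proof. by rewrite /Kqinv mcoeffZ mcoeff_dilate mulrA. Qed.

Lemma mcoeff_reflx i (p : Pol) m : (reflx i p)@_m = (-1) ^+ m i * p@_m.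
Proof. exact: mcoeff_dilate. Qed.

Lemma realization_linear x c (u v : Pol) :
  realization x (c *: u + v) = c *: realization x u + realization x v.
Proof.
case: x => i []; cbv beta iota delta [realization];
  apply/mpolyP => m; rewrite [RHS]mcoeffD mcoeffZ.
- by rewrite !mcoeff_XM mcoeffD mcoeffZ; case: eqP; rewrite ?mulr0 ?addr0.
- by rewrite !mcoeff_Dq mcoeffD mcoeffZ mulrDr mulrCA.
- by rewrite !mcoeff_Kq mcoeffD mcoeffZ mulrDr mulrCA.
- by rewrite !mcoeff_Kqinv mcoeffD mcoeffZ mulrDr mulrCA.
- by rewrite !mcoeff_reflx mcoeffD mcoeffZ mulrDr mulrCA.
Qed.

(* Under these hypotheses, the action of generators passes to the quotient. *)
Hypothesis qpowD : forall a b, qpow (a + b) = qpow a * qpow b.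
Hypothesis qpow1 : qpow 1 = q.
Hypothesis q_neq0 : q != 0.
Hypothesis q_sqr : q ^+ 2 != 1.

Lemma qpow0 : qpow 0 = 1.
Proof. 
by apply: (mulfI q_neq0); rewrite -qpow1 -qpowD addr0 mulr1. Qed.

Lemma qpow_neq0 a : qpow a != 0.
Proof.
apply/eqP => E; have := qpowD a (1 - a).
by rewrite addrC subrK qpow1 E mul0r => /eqP; rewrite (negPf q_neq0).
Qed.

Lemma qpowN a : qpow (- a) = (qpow a)^-1.
Proof.
apply: (mulfI (qpow_neq0 a)); rewrite -qpowD subrr qpow0 divff //.
exact: qpow_neq0.
Qed.

Lemma realization_osp_rel i a b : osp_rel qpow a b ->
  act (V := Pol) realization (subst (fun g => Gen F (i, g)) a)
  =1 act (V := Pol) realization (subst (fun g => Gen F (i, g)) b).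
Proof.
pose s := qpow 2^-1; have s0 : s != 0 by exact: qpow_neq0.
have half : 2^-1 + 2^-1 = 1 :> R by rewrite [RHS](splitr 1) !mul1r.
have q_s : q = s ^+ 2 by rewrite -qpow1 expr2 -qpowD half.
have s4 : s ^+ 4 != 1 by rewrite (exprM s 2 2) -q_s.
pose g := qpow (gamma i / 2); have g0 : g != 0 by exact: qpow_neq0.
pose M := qpow (mu i); have M0 : M != 0 by exact: qpow_neq0.
have gE : g ^+ 2 = M * s by rewrite expr2 -!qpowD -splitr.
have XS (m : 'X_{1..n.+1}) : m i != 0%N -> m i = ((m - U_(i))%MM i).+1.
  by move=> nz; rewrite mnmBE mnm1E eqxx subn1 prednK // lt0n.
pose d a := (M * (s ^+ 2 ^+ a - (-1) ^+ a) - M^-1 * (s ^- 2 ^+ a - (-1) ^+ a))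
              / (s ^+ 2 - s ^- 2).
have DqE (p : Pol) m : (Dq i p)@_m = d (m i).+1 * p@_(m + U_(i)).
  rewrite mcoeff_Dq !qpowN qpow1 q_s /d; congr (_ * _).
  by rewrite mulrBl; congr (_ - _); exact: mulrAC.
have XD (p : Pol) m : ('X_i * Dq i p)@_m = d (m i) * p@_m.
  rewrite mcoeff_XM; case: eqP => [->|/eqP nz].
    by rewrite /d !expr0 !subrr !mulr0 subrr !mul0r.
  by rewrite DqE -XS // submK // lep1mP.
have DX (p : Pol) m : (Dq i ('X_i * p))@_m = d (m i).+1 * p@_m.
  by rewrite DqE mcoeff_XM mnmDE mnm1E eqxx addn1 /= addmK.
have USi (m : 'X_{1..n.+1}) : (m + U_(i))%MM i = (m i).+1.
  by rewrite mnmDE mnm1E eqxx addn1.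
have sgn k : (-1) ^+ k * (-1) ^+ k = 1 :> F.
  by rewrite -exprD addnn -mul2n exprM sqrrN !expr1n.
case=> p; apply/mpolyP => m; cbn [subst act Sub];
  cbv beta iota delta [realization].
- rewrite mcoeff_Kq [RHS]mcoeffZ !mcoeff_XM; case: eqP => [_|/eqP nz].
    by rewrite !mulr0.
  rewrite mcoeff_Kqinv !qpowN -/s -/g {1}(XS m nz) exprS exprVn.
  by field; rewrite ?s0 ?g0 ?expf_neq0.
- rewrite mcoeff_Kq [RHS]mcoeffZ !DqE mcoeff_Kqinv !qpowN -/s -/g USi exprS exprVn.
  by field; rewrite ?s0 ?g0 ?expf_neq0.
- rewrite [LHS]mcoeffD [RHS]mcoeffZ [X in _ = _ * X]mcoeffD.
  rewrite (mcoeffZ _ (Kqinv i (Kqinv i p))) XD DX.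
  rewrite 2!mcoeff_Kq 2!mcoeff_Kqinv !qpowN -/s -/g exprVn.
  set S := s ^+ m i; have S0 : S != 0 by rewrite expf_neq0.
  have -> : g * S * (g * S * p@_m) = M * s * S ^+ 2 * p@_m by rewrite -gE; ring.
  have -> : g^-1 / S * (g^-1 / S * p@_m) = (M * s)^-1 / S ^+ 2 * p@_m.
    by rewrite -gE; field; rewrite g0 S0.
  have SE : s ^+ 2 ^+ m i = S ^+ 2 by rewrite -!exprM mulnC.
  rewrite /d !exprVn (exprS (s ^+ 2)) (exprS (- 1)) SE.
  set e := (-1) ^+ m i.
  have s4' : s ^+ 4 - 1 != 0 by rewrite subr_eq0.
  have s2' : s ^+ 2 - 1 != 0.
    by apply: contra s4; rewrite subr_eq0 (exprM s 2 2) => /eqP ->; rewrite expr1n.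
  by field; rewrite S0 s0 M0 -!expr2 -exprM s2' s4'.
- rewrite [LHS]mcoeffD [RHS]mcoeffZ mcoeff_reflx mcoeff_XM mcoeff_XM.
  case: eqP => [_|/eqP nz]; first by rewrite !mulr0 mul0r addr0.
  by rewrite mcoeff_reflx {1}(XS m nz) exprS; ring.
- rewrite [LHS]mcoeffD [RHS]mcoeffZ mcoeff_reflx !DqE mcoeff_reflx USi exprS.
  by ring.
- by rewrite mcoeff_reflx mcoeff_Kq mcoeff_Kq mcoeff_reflx; ring.
- by rewrite mcoeff_reflx mcoeff_Kqinv mcoeff_Kqinv mcoeff_reflx; ring.
- rewrite mcoeff_Kq mcoeff_Kqinv !qpowN -/s -/g [RHS]mcoeffZ exprVn.
  by field; rewrite ?s0 ?g0 ?expf_neq0.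
- rewrite mcoeff_Kqinv mcoeff_Kq !qpowN -/s -/g [RHS]mcoeffZ exprVn.
  by field; rewrite ?s0 ?g0 ?expf_neq0.
- by rewrite 2!mcoeff_reflx mulrA sgn [RHS]mcoeffZ.
Qed.

(* In the monomial basis, every generator acts by a shift of exponents and a
   factor, both involving the i-th exponent only. *)
Lemma mcoeff_realization i g : exists (c : nat -> F) (a b : nat),
  forall (p : Pol) m,
    (realization (i, g) p)@_m = c (m i) * p@_(m + U_(i) *+ a - U_(i) *+ b).
Proof.
case: g; cbv beta iota delta [realization].
- exists (fun k => (k != 0%N)%:R), 0%N, 1%N => p m.
  by rewrite mcoeff_XM mulm0n mulm1n addm0 /=; case: eqP; rewrite /= ?mul0r ?mul1r.
- exists (fun k => qpow (mu i) / (q - q^-1) * (qpow 1 ^+ k.+1 - (-1) ^+ k.+1)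
    - qpow (- mu i) / (q - q^-1) * (qpow (-1) ^+ k.+1 - (-1) ^+ k.+1)).
  by exists 1%N, 0%N => p m; rewrite mcoeff_Dq mulm0n subm0 mulm1n.
- exists (fun k => qpow (gamma i / 2) * qpow 2^-1 ^+ k), 0%N, 0%N => p m.
  by rewrite mcoeff_Kq mulm0n addm0 subm0.
- exists (fun k => qpow (- (gamma i / 2)) * qpow (- 2^-1) ^+ k), 0%N, 0%N.
  by move=> p m; rewrite mcoeff_Kqinv mulm0n addm0 subm0.
- exists (fun k => (-1) ^+ k), 0%N, 0%N => p m.
  by rewrite mcoeff_reflx mulm0n addm0 subm0.
Qed.

Lemma act_osp_tensor_eq (a b : expr F ('I_n.+1 * osp_gen)) :
  osp_tensor_eq qpow a b ->
  act (V := Pol) realization a =1 act (V := Pol) realization b.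
Proof.
apply: act_pres_eq => [|{}a {}b]; first exact: realization_linear.
case=> [i {}a {}b|i j g h ij p]; first exact: realization_osp_rel.
have [c [x [y E]]] := mcoeff_realization i g.
have [c' [x' [y' E']]] := mcoeff_realization j h.
cbn [act]; apply/mpolyP => m; rewrite E E' E' E mulrA [RHS]mulrA.
have sh k l u v (m' : 'X_{1..n.+1}) : k != l ->
    (m' + U_(k) *+ u - U_(k) *+ v)%MM l = m' l.
  by move=> /negPf kl; rewrite mnmBE mnmDE !mulmnE mnm1E kl !mul0n addn0 subn0.
rewrite !sh // 1?eq_sym // [c _ * _]mulrC; congr (_ * _@_ _).
apply/mnmP => l; rewrite !(mnmBE, mnmDE, mulmnE, mnm1E).
case: (eqVneq i l) => [<-|_]; last by rewrite !mul0n !addn0 !subn0.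
by rewrite eq_sym (negPf ij) !mul0n !addn0 !subn0.
Qed.

End Realization.

Lemma act_osp_tensor_eq_complex (R : realType) (n : nat) (q ell : R[i])
    (mu : 'I_n.+1 -> R) a b :
  q != 0 -> `|q| != 1 -> cexp ell = q -> osp_tensor_eq (cpow ell) a b ->
  act (V := {mpoly R[i][n.+1]}) (realization q (cpow ell) mu) a
  =1 act (V := {mpoly R[i][n.+1]}) (realization q (cpow ell) mu) b.
Proof.
move=> q0 q1 ellq; apply: act_osp_tensor_eq => //; first exact: cpowD.
  by rewrite cpow1.
apply: contra q1 => /eqP q2; have := normrX 2 q.
by rewrite q2 normr1 => /esym/eqP; rewrite sqrp_eq1.
Qed.

(* Main.v *)
Require Import Defs.
From HB Require Import structures.
From mathcomp Require Import all_boot all_order all_algebra.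
From mathcomp Require Import reals.
From mathcomp.real_closed Require Import complex.
From mathcomp Require Import mpoly.
From mathcomp Require Import ring lra zify.
From mathcomp Require boolp sequences exp trigo.

(* Restriction to x_{j+1} = 0 is injective on the kernel of D_{[j+1]}, and CK is
   its inverse. The Casimir operator Gamma of the factors m and m+1 commutes
   with D_{[j]} and X_{[j]} for j > m, hence with every later CK and X in psi_j,
   so that only u_{a,b} = CK_{m+1} (X_{[m]}^b u_a), u_a = CK_m (X_{[m-1]}^a phi),
   a = j_{m-1}, b = j_m, has to be treated. There Gamma turns, by restriction to
   x_{m+1} = 0, into an operator T on polynomials in m variables. The deviations
   D T + q T D and T X - X T, for D = D_{[m]} and X = X_{[m]}, are sums of
   operators that q-commute with D and X. This gives T u_a in <u_a, X u_{a-1}>,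
   then T X^b u_a in <X^{b+1} u_{a-1}, X^b u_a, X^{b-1} u_{a+1}>, with explicit
   coefficients. The outer ones are products of factors that vanish only if
   q^x = 1 or q^x = -1 for some x > 0. *)

Set Implicit Arguments.
Unset Strict Implicit.
Unset Printing Implicit Defensive.

Import Order.TTheory GRing.Theory Num.Theory.
Local Open Scope ring_scope.
Local Open Scope complex_scope.

(** * Deciding equalities of linear combinations *)

(** On polynomials in the first j variables, D_{[j]} and X_{[j]} are the images of A_- and A_+ under
    the iterated coproduct. Hence they satisfy the relations of osp_q(1|2), commutation with Gamma
    for later j follows from coassociativity and centrality of the Casimir element, and all operator
    identities can be proved by normal ordering for abstract commuting representations. The obstacle
    is that Gamma need not commute with D_{[m]} or X_{[m]}, and that it contains the lowering
    operator in x_{m+1}, which does not survive restriction to x_{m+1} = 0. The equation D_{[m+1]} u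
    = 0 expresses that operator through the first m variables; this is the origin of T. Expansions
    are found by descent: applying D once or twice gives a multiple of a known element of ker D, and
    restriction to x_m = 0 fixes what D does not see. Every coefficient is a quotient of scalars
    arising in this way. Throughout, s = q^{1/2}. The assumption on |q| enters as (q^x)^2 != 1 for
    real x != 0, which excludes q^x = 1 and q^x = -1 together. *)

Inductive lexp (F : Type) : Type :=
| LZero | LAtom of nat | LAdd of lexp F & lexp F | LOpp of lexp F
| LScale of F & lexp F.
Arguments LZero {F}.
Arguments LAtom {F}.

Fixpoint ldenote (F : fieldType) (V : lmodType F) (env : seq V) (e : lexp F) :
  V :=
  match e with
  | LZero => 0
  | LAtom i => nth 0 env i
  | LAdd a b => ldenote env a + ldenote env b
  | LOpp a => - ldenote env a
  | LScale c a => c *: ldenote env a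
  end.

Fixpoint lcoef (F : fieldType) (i : nat) (e : lexp F) : F :=
  match e with
  | LZero => 0
  | LAtom j => if Nat.eqb i j then 1 else 0
  | LAdd a b => lcoef i a + lcoef i b
  | LOpp a => - lcoef i a
  | LScale c a => c * lcoef i a
  end.

Fixpoint lcoef_eq (F : fieldType) (n : nat) (a b : lexp F) : Prop :=
  if n is n'.+1 then lcoef n' a = lcoef n' b /\ lcoef_eq n' a b else True.

Lemma ldenoteE (F : fieldType) (V : lmodType F) (env : seq V) (e : lexp F) :
  ldenote env e = \sum_(i < size env) lcoef i e *: nth 0 env i.
Proof.
elim: e => [|j|a IHa b IHb|a IHa|c a IHa] /=; rewrite ?IHa ?IHb.
- by rewrite big1 // => i _; rewrite scale0r.
- have [lt|le] := ltnP j (size env).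
    rewrite (bigD1 (Ordinal lt)) //= PeanoNat.Nat.eqb_refl scale1r big1 ?addr0
      //.
    move=> i /eqP ne; case: PeanoNat.Nat.eqb_spec => [ij|_];
      last by rewrite scale0r.
    by case: ne; apply: val_inj.
  rewrite nth_default // big1 // => i _.
  case: PeanoNat.Nat.eqb_spec => [ij|_]; last by rewrite scale0r.
  by move: (ltn_ord i); rewrite ij ltnNge le.
- by rewrite -big_split; apply: eq_bigr => i _; rewrite scalerDl.
- by rewrite -sumrN; apply: eq_bigr => i _; rewrite scaleNr.
- by rewrite scaler_sumr; apply: eq_bigr => i _; rewrite scalerA.
Qed.

Lemma lcoef_eqP (F : fieldType) (V : lmodType F) (env : seq V) (a b : lexp F) :
  lcoef_eq (size env) a b -> ldenote env a = ldenote env b.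
Proof.
move=> E; rewrite !ldenoteE; apply: eq_bigr => -[i /= lti] _; congr (_ *: _).
by elim: (size env) E i lti => //= n IH [E /IH{}IH] i;
  rewrite ltnS leq_eqVlt => /predU1P[->|/IH].
Qed.

(* Equal atoms may differ in their canonical structures, hence [unify]. *)
Ltac lindex x env :=
  match env with
  | ?y :: _ => let _ := match goal with _ => unify x y end in constr:(0%N)
  | _ :: ?t => let n := lindex x t in constr:(n.+1)
  end.
Ltac latom env x :=
  match goal with
  | _ => let _ := lindex x env in env
  | _ => constr:(x :: env)
  end.
Ltac lenv env t :=
  lazymatch t with
  | 0 => env
  | ?a + ?b => let env := lenv env a in lenv env b
  | - ?a => lenv env a
  | _ *: ?a => lenv env a
  | _ => latom env t
  end.
Ltac lreify F env t :=
  lazymatch t with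
  | 0 => constr:(@LZero F)
  | ?a + ?b => let a := lreify F env a in let b := lreify F env b in
               constr:(LAdd a b)
  | - ?a => let a := lreify F env a in constr:(LOpp a)
  | ?c *: ?a => let a := lreify F env a in constr:(LScale c a)
  | _ => let i := lindex t env in constr:(@LAtom F i)
  end.

(** Leaves one scalar equation per atom, an atom being a subterm that is not built by [0], [+], [-]
    or [*:]. Atoms need not be independent: equal coefficients suffice. *)
Ltac lmod F :=
  lazymatch goal with
  | |- @eq ?V ?a ?b =>
    let env := lenv constr:(@nil V) a in
    let env := lenv env b in
    let ra := lreify F env a in
    let rb := lreify F env b in
    apply: (@lcoef_eqP F _ env ra rb);
    cbn [lcoef_eq lcoef size Nat.eqb]; repeat split
  end.

Section LinearCombinations.
Variables (F : fieldType) (V : lmodType F) (f : {linear V -> V}).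

Lemma linear1 x b y : f (x + b *: y) = f x + b *: f y.
Proof. by rewrite linearD linearZ. Qed.

Lemma linear2 a x b y : f (a *: x + b *: y) = a *: f x + b *: f y.
Proof. by rewrite linearD !linearZ. Qed.

Lemma linear3 a x b y c z :
  f (a *: x + b *: y + c *: z) = a *: f x + b *: f y + c *: f z.
Proof. by rewrite !linearD !linearZ. Qed.

Lemma iter_scale n a x : iter n f (a *: x) = a *: iter n f x.
Proof. by elim: n => // n IH; rewrite !iterS IH linearZ. Qed.

Lemma iter_linear2 n a x b y :
  iter n f (a *: x + b *: y) = a *: iter n f x + b *: iter n f y.
Proof. by elim: n => // n IH; rewrite !iterS IH linear2. Qed.

Lemma iter_linear3 n a x b y c z :
  iter n f (a *: x + b *: y + c *: z) =
  a *: iter n f x + b *: iter n f y + c *: iter n f z.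
Proof. by elim: n => // n IH; rewrite !iterS IH linear3. Qed.

End LinearCombinations.

(** * Representations of osp_q(1|2) and its coproduct *)

Section OspOperators.
Variables (F : fieldType) (V : lmodType F) (s : F).
Hypotheses (s0 : s != 0) (s4 : s ^+ 4 != 1).

Definition ops := osp_gen -> {linear V -> V}.

(** The defining relations oriented as rewrite rules. In normal words the raising operators stand
    leftmost, then the lowering operators, then powers of K, then P. *)
Record osp_ops (r : ops) : Prop := OspOps {
  ospKX : forall p, r genK (r genAp p) = s *: r genAp (r genK p);
  ospKD : forall p, r genK (r genAm p) = s^-1 *: r genAm (r genK p);
  ospK'X : forall p, r genKinv (r genAp p) = s^-1 *: r genAp (r genKinv p);
  ospK'D : forall p, r genKinv (r genAm p) = s *: r genAm (r genKinv p);
  ospDX : forall p, r genAm (r genAp p) = - r genAp (r genAm p)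
    + (s - s^-1)^-1 *: (r genK (r genK p) - r genKinv (r genKinv p));
  ospPX : forall p, r genP (r genAp p) = - r genAp (r genP p);
  ospPD : forall p, r genP (r genAm p) = - r genAm (r genP p);
  ospPK : forall p, r genP (r genK p) = r genK (r genP p);
  ospPK' : forall p, r genP (r genKinv p) = r genKinv (r genP p);
  ospKK' : forall p, r genK (r genKinv p) = p;
  ospK'K : forall p, r genKinv (r genK p) = p;
  ospPP : forall p, r genP (r genP p) = p }.

(* The orientation is chosen so that rewriting moves the operators of r1 to the
   left. *)
Definition commuting (r1 r2 : ops) :=
  forall g h p, r2 h (r1 g p) = r1 g (r2 h p).

(** The action through the counit, on which iterated coproducts can start. *)
Definition trivial_ops : ops := fun g =>
  match g with
  | genAp | genAm => GRing.null_fun V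
  | _ => idfun
  end.

Definition coprod (r1 r2 : ops) : ops := fun g =>
  match g with
  | genAp => (r1 genAp \o (r2 genK \o r2 genP)) \+ (r1 genKinv \o r2 genAp)
  | genAm => (r1 genAm \o (r2 genK \o r2 genP)) \+ (r1 genKinv \o r2 genAm)
  | genK => r1 genK \o r2 genK
  | genKinv => r1 genKinv \o r2 genKinv
  | genP => r1 genP \o r2 genP
  end.

Definition casimir_op (r : ops) (p : V) : V :=
  - r genAp (r genAm (r genP p))
  + (s^-1 / (s ^+ 2 - s ^- 2)) *: r genK (r genK (r genP p))
  - (s / (s ^+ 2 - s ^- 2)) *: r genKinv (r genKinv (r genP p)).

Lemma s2_neq1 : s ^+ 2 - 1 != 0.
Proof.
by apply: contra s4; rewrite subr_eq0 (exprM s 2 2) => /eqP->; rewrite expr1n.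
Qed.

Lemma s2_neqN1 : s ^+ 2 + 1 != 0.
Proof.
by apply: contra s4; rewrite addr_eq0 (exprM s 2 2) => /eqP->;
  rewrite sqrrN expr1n.
Qed.

Lemma s4_sub1 : s ^+ 4 - 1 != 0.
Proof. by rewrite subr_eq0. Qed.

Lemma trivial_osp : osp_ops trivial_ops.
Proof.
by split=> p; rewrite /= ?(linear0, scaler0, oppr0, subrr, addr0, raddf0).
Qed.

Lemma commuting_trivial r : commuting trivial_ops r.
Proof. by move=> [] h p /=; rewrite ?linear0. Qed.

Lemma commuting_coprod r1 r2 r3 :
  commuting r1 r3 -> commuting r2 r3 -> commuting (coprod r1 r2) r3.
Proof. by move=> c13 c23 [] h p /=; rewrite ?linearD !(c13, c23). Qed.

Definition ospE r (h : osp_ops r) :=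
  (ospKX h, ospKD h, ospK'X h, ospK'D h, ospDX h, ospPX h, ospPD h, ospPK h,
   ospPK' h, ospKK' h, ospK'K h, ospPP h).

(* The operator family is explicit: scaling and opposite are linear maps too, so
   that rewriting with linearity of an arbitrary map would loop. *)
Section Linearity.
Variable r : ops.
Lemma opsN g u : r g (- u) = - r g u. Proof. exact: linearN. Qed.
Lemma opsD g u v : r g (u + v) = r g u + r g v. Proof. exact: linearD. Qed.
Lemma opsZ g a u : r g (a *: u) = a *: r g u. Proof. exact: linearZ. Qed.
Definition linE := (opsD, opsZ, opsN).
End Linearity.

Lemma coprod_osp r1 r2 :
  osp_ops r1 -> osp_ops r2 -> commuting r1 r2 -> osp_ops (coprod r1 r2).
Proof.
have [p1 m1] := (s2_neq1, s2_neqN1).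
move=> h1 h2 c12; split=> p; rewrite /= ?(linE r1, linE r2, c12, ospE h1,
  ospE h2) /=.
all: lmod F.
all: by field; rewrite ?s0 ?p1 ?m1.
Qed.

Lemma coprodA r1 r2 r3 : commuting r1 r2 -> commuting r2 r3 -> osp_ops r2 ->
  forall g p, coprod (coprod r1 r2) r3 g p = coprod r1 (coprod r2 r3) g p.
Proof.
move=> c12 c23 h2 [] p; rewrite /= ?(linE r1, linE r2, linE r3, c12, c23,
  ospE h2) /= //; lmod F.
all: ring.
Qed.

Lemma casimir_linear r : linear (casimir_op r).
Proof.
by move=> c u v; rewrite /casimir_op !(linE r); lmod F; ring.
Qed.

HB.instance Definition _ r :=
  GRing.isLinear.Build F V V *:%R (casimir_op r) (casimir_linear r).

Lemma casimir_central r : osp_ops r ->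
  forall g p, casimir_op r (r g p) = r g (casimir_op r p).
Proof.
have p1 := s2_neq1.
move=> h [] p; rewrite /casimir_op ?(linE r, ospE h) /=; lmod F.
all: by field; rewrite ?s0 -?expr2 -?exprM ?s4_sub1 ?p1.
Qed.

Lemma coprod_comm (f : {linear V -> V}) (r1 r2 : ops) :
  (forall g p, f (r1 g p) = r1 g (f p)) -> (forall g p,
    f (r2 g p) = r2 g (f p)) ->
  forall g p, f (coprod r1 r2 g p) = coprod r1 r2 g (f p).
Proof. by move=> f1 f2 [] p /=; rewrite ?linearD !(f1, f2). Qed.

Lemma casimir_comm (f : {linear V -> V}) (r : ops) : (forall g p,
  f (r g p) = r g (f p)) ->
  forall p, f (casimir_op r p) = casimir_op r (f p).
Proof.
move=> fr p; have fN x : f (- x) = - f x by exact: linearN.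
have fZ a x : f (a *: x) = a *: f x by exact: linearZ.
by rewrite /casimir_op !linearD !(fN, fZ) !fr.
Qed.

(** For s^2 = q and M = q^mu this is [mu, a; q]. Other values of M occur because X_{[j]}^a applied
    to a lowest weight vector is lowered by the same expression, with M determined by the weight. *)
Definition lowest_coef (M : F) (a : nat) : F :=
  (M * (s ^+ 2 ^+ a - (-1) ^+ a) - M^-1 * (s ^- 2 ^+ a - (-1) ^+ a))
  / (s ^+ 2 - s ^- 2).

Lemma lowest_coef_neq0 M a : M != 0 -> s ^+ 2 ^+ a ^+ 2 != 1 ->
  (M ^+ 2 * s ^+ 2 ^+ a) ^+ 2 != 1 -> lowest_coef M a != 0.
Proof.
move=> M0 n1 n2; rewrite /lowest_coef exprVn.
have z0 : s ^+ 2 ^+ a != 0 by rewrite !expf_neq0.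
have e2 : (-1) ^+ a ^+ 2 = 1 :> F by rewrite exprAC sqrrN !expr1n.
move: (s ^+ 2 ^+ a) z0 n1 n2 e2 => z z0 n1 n2; move: ((-1) ^+ a) => e e2.
have qq : s ^+ 2 - s ^- 2 != 0.
  have E : s ^+ 4 - 1 = (s ^+ 2 - s ^- 2) * s ^+ 2 by field.
  by have := s4_sub1; rewrite E mulf_eq0 negb_or => /andP[].
(* Up to a term that vanishes because e is a sign, the numerator factors. *)
have -> : M * (z - e) - M^-1 * (z^-1 - e) =
    (z - e) * (M ^+ 2 * z + e) / (M * z) + (e ^+ 2 - 1) / (M * z).
  by field; rewrite M0 z0.
rewrite e2 subrr mul0r addr0 !mulf_neq0 ?invr_neq0 ?mulf_neq0 //.
  by apply: contra n1; rewrite subr_eq0 => /eqP ->; rewrite e2.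
by apply: contra n2; rewrite addr_eq0 => /eqP ->; rewrite sqrrN e2.
Qed.

Section LowestWeight.
Variables (r : ops) (phi : V) (h : F).
Hypotheses (hr : osp_ops r) (h0 : h != 0).
Hypotheses (Dphi : r genAm phi = 0) (Kphi : r genK phi = h *: phi).

Lemma iter_raise_K a :
  r genK (iter a (r genAp) phi) = (h * s ^+ a) *: iter a (r genAp) phi.
Proof.
elim: a => [|a IH]; first by rewrite mulr1.
by rewrite iterS (ospKX hr) IH (opsZ r) scalerA exprS mulrCA.
Qed.

Lemma lower_iter_raise a : r genAm (iter a (r genAp) phi) =
  lowest_coef (h ^+ 2 / s) a *: iter a.-1 (r genAp) phi.
Proof.
have ss1 : s * s - 1 != 0 by rewrite -expr2 s2_neq1.
elim: a => [|a IH].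
  by rewrite /lowest_coef !expr0 !subrr !mulr0 subrr mul0r scale0r.
have K'E : r genKinv (iter a (r genAp) phi) = (h * s ^+ a)^-1 *: iter a (r
  genAp) phi.
  rewrite -[in RHS](ospK'K hr (iter a _ _)) iter_raise_K (opsZ r) scalerA.
  by rewrite mulVf ?scale1r // mulf_neq0 ?expf_neq0.
rewrite iterS (ospDX hr) iter_raise_K K'E !(opsZ r) iter_raise_K K'E IH (opsZ
  r).
(* For a = 0 the coefficient vanishes, so the default value of [a.-1] does no harm. *)
have -> : lowest_coef (h ^+ 2 / s) a *: r genAp (iter a.-1 (r genAp) phi) =
    lowest_coef (h ^+ 2 / s) a *: iter a (r genAp) phi.
  case: a {IH K'E} => //; rewrite /lowest_coef !expr0 !subrr !mulr0 subrr mul0r.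
  by rewrite !scale0r.
have t0 : s ^+ a != 0 by rewrite expf_neq0.
have E : s ^+ 2 ^+ a = (s ^+ a) ^+ 2 by rewrite exprAC.
lmod F; rewrite /lowest_coef !exprVn (exprS _ a) (exprS (-1) a) E.
move: (s ^+ a) t0 ((-1) ^+ a) => t t0 e.
have s41 : s ^+ 4 - 1 != 0 by rewrite s4_sub1.
by field; rewrite s0 h0 t0 ss1 -!expr2 -exprM s41.
Qed.

End LowestWeight.
End OspOperators.

(** * The reduced Casimir operator on two factors *)

Section TwoFactors.
Variables (F : fieldType) (V : lmodType F) (s : F).
Hypotheses (s0 : s != 0) (s4 : s ^+ 4 != 1).
Variables (r1 r2 : ops V) (h1 : osp_ops s r1) (h2 : osp_ops s r2).
Hypothesis c12 : commuting r1 r2.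
Variables (g : F) (g0 : g != 0).

Local Notation D := (coprod r1 r2 genAm).
Local Notation X := (coprod r1 r2 genAp).
Local Notation K := (coprod r1 r2 genK).
Local Notation K' := (coprod r1 r2 genKinv).

(* D = left_lower + right_lower; twist and right_raise are the remaining pieces
   of the Casimir operator and of X that q-commute with both. *)
Definition left_lower p := r1 genAm (r2 genK (r2 genP p)).
Definition right_lower p := r1 genKinv (r2 genAm p).
Definition right_raise p := r1 genKinv (r2 genAp p).
Definition twist p := r2 genKinv (r2 genKinv (r2 genP p)).

(* What the Casimir operator of factors 2 and 3 becomes on the kernel of
   D_{123} after restriction to x_3 = 0, with g = q^{gamma_3}. *)
Definition reduced_casimir p :=
  - g *: r1 genK (r1 genAm (r2 genAp (r2 genK p)))
  + (g * s^-1 / (s ^+ 2 - s ^- 2)) *: r2 genK (r2 genK (r2 genP p))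
  - (g^-1 * s / (s ^+ 2 - s ^- 2)) *: twist p.

Let p1 := s2_neq1 s4.
Let m1 := s2_neqN1 s4.
Let s41 := s4_sub1 s4.

Ltac osp_field :=
  rewrite /= /reduced_casimir /left_lower /right_lower /right_raise /twist
    ?(linE r1, linE r2, c12, ospE h1, ospE h2) /=; lmod F;
  try (field; rewrite ?s0 ?g0 -?expr2 -?exprM ?s41 ?p1 ?m1 //).

Lemma lower_casimir p : D (reduced_casimir p) =
  - s ^+ 2 *: reduced_casimir (D p)
  + twist ((g - s ^+ 2 / g) / (s - s^-1) *: left_lower p - (s / g) *:
    right_lower p).
Proof. osp_field. Qed.

Lemma lower_left p : D (twist (left_lower p)) = twist (left_lower (D p)).
Proof. osp_field. Qed.

Lemma casimir_raise p : reduced_casimir (X p) = X (reduced_casimir p)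
  + (s - s^-1)^-1 *: right_raise (twist (g^-1 *: p - g *: K (K (K (K p))))).
Proof. osp_field. Qed.

Lemma right_raiseX p :
  right_raise (twist (X p)) = - s ^- 2 *: X (right_raise (twist p)).
Proof. osp_field. Qed.

Lemma lower_right_raise p : D (right_raise (twist p)) =
  (s - s^-1)^-1 *: K' (K' (r2 genK (r2 genK (r2 genP p)) - twist p))
  + s ^- 2 *: right_raise (twist (D p))
  - (1 + s ^- 2) *: right_raise (twist (left_lower p)).
Proof. osp_field. Qed.

Lemma lower2_right_raise p : D p = 0 -> D (D (right_raise (twist p))) =
  ((s + s^-1) * s ^- 2) *: K' (K' (twist (left_lower p))).
Proof.
(* Normal ordering cannot use D p = 0, since D p is a sum of two words. So an unconditional identity
   is proved, with correction terms that all contain D p. *)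
move=> Dp0; have -> : D (D (right_raise (twist p))) =
    ((s + s^-1) * s ^- 2) *: K' (K' (twist (left_lower p)))
    + (s ^- 2 / (s - s^-1)) *:
        K' (K' (s ^- 2 *: twist (D p) - s ^+ 2 *: r2 genK (r2 genK (r2 genP (D
          p)))))
    + s ^- 2 *: D (right_raise (twist (D p)))
    + (1 + s ^- 2) *: right_raise (twist (left_lower (D p))).
  osp_field.
rewrite Dp0 /right_raise /twist /left_lower.
by rewrite !(linear0, scaler0, subr0, addr0).
Qed.

Lemma K_left p : K (twist (left_lower p)) = s^-1 *: twist (left_lower (K p)).
Proof. osp_field. Qed.

Lemma twist_linear : linear twist.
Proof. by move=> x u v; rewrite /twist !(linE r2). Qed.
Lemma right_raise_linear : linear right_raise.
Proof. by move=> x u v; rewrite /right_raise !(linE r1, linE r2). Qed.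
Lemma left_lower_linear : linear left_lower.
Proof. by move=> x u v; rewrite /left_lower !(linE r1, linE r2). Qed.
HB.instance Definition _ := GRing.isLinear.Build F V V *:%R twist twist_linear.
HB.instance Definition _ :=
  GRing.isLinear.Build F V V *:%R right_raise right_raise_linear.
HB.instance Definition _ :=
  GRing.isLinear.Build F V V *:%R left_lower left_lower_linear.
Lemma reduced_casimir_linear : linear reduced_casimir.
Proof.
move=> x u v; rewrite /reduced_casimir /twist !(linE r1, linE r2) /=.
by lmod F; ring.
Qed.
HB.instance Definition _ :=
  GRing.isLinear.Build F V V *:%R reduced_casimir reduced_casimir_linear.

(* In the application u is u_a, u' is u_{a+1} and twist (left_lower u) is a
   multiple of u_{a-1}; the latter vanishes for a = 0. *)
Section Step.
Variables (rho : {linear V -> V}) (G : F) (G0 : G != 0).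
Hypothesis rho_r1 : forall x p, rho (r1 x p) = r1 x (rho p).
Hypothesis rhoX : forall p, rho (r2 genAp p) = 0.
Hypothesis rhoK : forall p, rho (r2 genK p) = G *: rho p.
Hypothesis rhoP : forall p, rho (r2 genP p) = rho p.
Hypothesis inj : forall p, D p = 0 -> rho p = 0 -> p = 0.
Variables (u u' v : V) (h d : F).
Hypothesis Du : D u = 0.
Hypothesis rho_u : rho u = v.
Hypothesis Kv : r1 genK v = (h / G) *: v.
Hypothesis Du' : D u' = 0.
Hypothesis rho_u' : rho u' = r1 genAp v.
Hypothesis XDv : r1 genAp (r1 genAm v) = d *: v.
Hypotheses (h0 : h != 0) (h4 : h ^+ 4 != 1) (h4s : h ^+ 4 != s ^+ 4).
Hypothesis h4Ns : h ^+ 4 + s ^+ 2 != 0.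

Local Notation w := (twist (left_lower u)).

Local Notation linX := (linE (coprod r1 r2)).

(** The tool behind all expansions below: each is checked after D, where both sides are already
    known, and after restriction. *)
Lemma lower_rho_inj y z : D y = D z -> rho y = rho z -> y = z.
Proof.
move=> Dyz ryz; apply/eqP; rewrite -subr_eq0; apply/eqP.
by apply: inj; rewrite linearB ?Dyz ?ryz subrr.
Qed.

Lemma rhoK' p : rho (r2 genKinv p) = G^-1 *: rho p.
Proof. by rewrite -[in RHS](ospKK' h2 p) rhoK scalerA mulVf // scale1r. Qed.

Lemma rho_raise p : rho (X p) = G *: r1 genAp (rho p).
Proof.
by rewrite /= linearD !rho_r1 rhoX linear0 addr0 rhoK rhoP (opsZ r1).
Qed.

Let h12 := coprod_osp s0 s4 h1 h2 c12.

Lemma K'_eigen p x : x != 0 -> K p = x *: p -> K' p = x^-1 *: p.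
Proof.
move=> x0 Kp; rewrite -[in RHS](ospK'K h12 p) Kp.
by rewrite linX scalerA mulVf // scale1r.
Qed.

(** K u is again killed by D and its restriction is a multiple of v, so injectivity makes u a weight
    vector. *)
Lemma Ku : K u = h *: u.
Proof.
apply/eqP; rewrite -subr_eq0; apply/eqP; apply: inj.
  have DK : D (K u) = 0.
    move: (ospKD h12 u); rewrite Du linear0 => /esym/eqP.
    by rewrite scaler_eq0 invr_eq0 (negPf s0) => /eqP.
  by rewrite linearB linX DK Du scaler0 subr0.
rewrite linearB linearZ /= rho_r1 rhoK rho_u (opsZ r1) Kv scalerA.
by rewrite mulrC divfK // subrr.
Qed.

Lemma Dw : D w = 0.
Proof. by rewrite lower_left Du !linear0. Qed.

Lemma Kw : K w = (h / s) *: w.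
Proof. by rewrite K_left Ku !linearZ /= scalerA mulrC. Qed.

Lemma rho_w : rho w = G^-1 *: r1 genAm v.
Proof.
rewrite /twist /left_lower !rhoK' rhoP rho_r1 rhoK rhoP rho_u.
by rewrite (opsZ r1) !scalerA; congr (_ *: _); field.
Qed.

Lemma rho_Xw : rho (X w) = d *: v.
Proof. by rewrite rho_raise rho_w (opsZ r1) scalerA mulfV // scale1r XDv. Qed.

Lemma lowerX_eigen p x : x != 0 -> K p = x *: p ->
  D (X p) = - X (D p) + ((x ^+ 2 - x ^- 2) / (s - s^-1)) *: p.
Proof.
move=> x0 Kp; have K'p := K'_eigen x0 Kp.
rewrite (ospDX h12) Kp K'p !linX Kp K'p !scalerA.
by lmod F; field; rewrite x0 s0 -?expr2 s2_neq1.
Qed.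

Let hs0 : h / s != 0. Proof. by rewrite mulf_neq0 ?invr_neq0. Qed.

Lemma DXw : D (X w) = ((h ^+ 4 - s ^+ 4) / (s ^+ 2 * h ^+ 2 * (s - s^-1))) *: w.
Proof.
rewrite (lowerX_eigen hs0 Kw) Dw linear0 oppr0 add0r; congr (_ *: _).
by field; rewrite s0 h0 -expr2 s2_neq1.
Qed.

Lemma DXXw : D (X (X w)) = ((h ^+ 4 + s ^+ 2) / (s * h ^+ 2)) *: X w.
Proof.
have KXw : K (X w) = h *: X w.
  by rewrite (ospKX h12) Kw linX scalerA mulrC divfK.
rewrite (lowerX_eigen h0 KXw) DXw linX -scaleNr -scalerDl; congr (_ *: _).
by field; rewrite s0 h0 -expr2 s2_neq1.
Qed.

Lemma DXu : D (X u) = ((h ^+ 4 - 1) / (h ^+ 2 * (s - s^-1))) *: u.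
Proof.
rewrite (lowerX_eigen h0 Ku) Du linear0 oppr0 add0r; congr (_ *: _).
by field; rewrite s0 h0 -expr2 s2_neq1.
Qed.

Let h4s' : h ^+ 4 - s ^+ 4 != 0. Proof. by rewrite subr_eq0. Qed.
Let ss1 : s * s - 1 != 0. Proof. by rewrite -expr2 s2_neq1. Qed.
Let h41' : h ^+ 4 - 1 != 0. Proof. by rewrite subr_eq0. Qed.

(** The quotient of the coefficients of w in [D (reduced_casimir u)] and in [D (X w)]. *)
Definition raise_coef := (g - g^-1) * s ^+ 2 * h ^+ 2 / (h ^+ 4 - s ^+ 4).

Lemma reduced_casimir_u : exists tau,
  reduced_casimir u = tau *: u + raise_coef *: X w.
Proof.
pose x := (g * s^-1 * G ^+ 2 - g^-1 * s / G ^+ 2) / (s ^+ 2 - s ^- 2).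
exists (x - raise_coef * d).
have DR : D (reduced_casimir u) = raise_coef *: D (X w).
  rewrite lower_casimir Du DXw.
  (* By D u = 0 the two halves of D cancel on u, so both deviation terms are multiples of w. *)
  have -> : right_lower u = - left_lower u.
    by apply/eqP; rewrite -addr_eq0 addrC -Du.
  rewrite linear0 linearB !linearZ /= (linearN (twist)) /=.
  lmod F; rewrite /raise_coef; field.
  by rewrite s0 g0 h0 -?expr2 s2_neq1 ?h4s'.
have rhoR : rho (reduced_casimir u) = x *: v.
  rewrite /reduced_casimir /twist !(linearD, linearN, linearZ) /=.
  rewrite !rho_r1 rhoX !rhoK !rhoK' !rhoP rho_u !linear0.
  by lmod F; rewrite /x; field; rewrite s0 g0 G0 -?expr2 -?exprM ?(s4_sub1 s4).
apply: lower_rho_inj; rewrite linear2 ?DR ?Du ?rhoR ?rho_u ?rho_Xw.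
  by rewrite scaler0 add0r.
by lmod F; ring.
Qed.

(** Of u', X u and X X w, only the last survives D twice, which determines [right_raise_coef2].
    Comparing restrictions at the end gives [right_raise_coef0]. *)
Definition right_raise_coef2 := (s + s^-1) * s ^+ 3 * h ^+ 2 * (s - s^-1)
  / ((h ^+ 4 - s ^+ 4) * (h ^+ 4 + s ^+ 2)).
Definition right_raise_coef0 := - (G / (h ^+ 4 - 1)) * (G ^+ 2 - G ^- 2
  + (s ^+ 2 - s ^- 2) * s * h ^+ 2 * d / (h ^+ 4 + s ^+ 2)).

(** Descent for y = [right_raise (twist u)]: D D y is a multiple of w; this and the restriction of D
    y determine D y; this and the restriction of y determine y. The latter restriction is zero, as
    [right_raise] multiplies by the restricted variable. *)
Lemma right_raise_u : exists tau,
  right_raise (twist u) =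
    right_raise_coef0 *: u' + tau *: X u + right_raise_coef2 *: X (X w).
Proof.
have K'w := K'_eigen hs0 Kw.
set y := right_raise (twist u).
have DDy : D (D y) = ((s + s^-1) / h ^+ 2) *: w.
  rewrite (lower2_right_raise Du) !(K'w, linX) !scalerA.
  by congr (_ *: _); field; rewrite s0 h0.
have rhoDy : rho (D y) = ((G ^+ 2 - G ^- 2) / (h ^+ 2 * (s - s^-1))) *: v.
  have rhoR p : rho (right_raise p) = 0.
    by rewrite /right_raise rho_r1 rhoX linear0.
  have rhoKK p : rho (K' p) = G^-1 *: r1 genKinv (rho p).
    by rewrite /= rho_r1 rhoK' (opsZ r1).
  have K'v : r1 genKinv v = (h / G)^-1 *: v.
    rewrite -[in RHS](ospK'K h1 v) Kv (opsZ r1) scalerA mulVf ?scale1r //.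
    by rewrite mulf_neq0 ?invr_neq0.
  rewrite lower_right_raise Du.
  rewrite linearB linearD 3!linearZ !rhoR !rhoKK linearB !rhoK' !rhoK rhoP
    rho_u /=.
  rewrite !scaler0 subr0 addr0.
  rewrite !(linE r1, K'v); lmod F.
  by field; rewrite s0 h0 G0 -?expr2 s2_neq1.
have rhoy : rho y = 0.
  by rewrite /y /right_raise rho_r1 rhoX linear0.
(* The coefficient of v in the restriction of D y, less the share of the X w component, which
   restricts to a multiple of v too. *)
pose eta := (G ^+ 2 - G ^- 2) / (h ^+ 2 * (s - s^-1))
  - right_raise_coef2 * ((h ^+ 4 + s ^+ 2) / (s * h ^+ 2)) * d.
have Dy : D y = eta *: u + (right_raise_coef2 * ((h ^+ 4 + s ^+ 2) / (s * h ^+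
  2))) *: X w.
  apply: lower_rho_inj; rewrite linear2 ?DDy ?rhoDy ?Du ?DXw ?rho_u ?rho_Xw;
    lmod F.
    by rewrite /right_raise_coef2; field; rewrite s0 h0 ss1 h4Ns h4s'.
  by rewrite /eta; ring.
exists (eta * (h ^+ 2 * (s - s^-1)) / (h ^+ 4 - 1)).
apply: lower_rho_inj; rewrite linear3 ?Dy ?rhoy ?Du' ?DXu ?DXXw.
  by lmod F; field; rewrite s0 h0 ss1 h41'.
rewrite rho_u' !rho_raise rho_u rho_w !(opsZ r1) XDv (opsZ r1).
lmod F; rewrite /eta /right_raise_coef0 /right_raise_coef2.
by field; rewrite s0 h0 G0 ss1 h4s' h41' h4Ns.
Qed.

Local Notation Q b := ((- s ^+ 2) ^+ b).

(** The sum over i < b of (g^{-1} Q_i^{-1} - g h^4 Q_i) / (s - s^{-1}), where Q_i = (- s^2)^i: each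
    transport of the reduced Casimir operator past one X adds one term. Both geometric series
    contain the factor 1 - Q_b. *)
Definition iter_coef b :=
  (1 - Q b) / ((1 + s ^+ 2) * (s - s^-1)) * (- s ^+ 2 / (g * Q b) - g * h ^+ 4).

Lemma iterX_lin b (f : {linear V -> V}) (e : F) :
  (forall p, f (X p) = e *: X (f p)) ->
  forall p, f (iter b X p) = e ^+ b *: iter b X (f p).
Proof.
move=> fX p; elim: b => [|b IH]; first by rewrite scale1r.
by rewrite !iterS fX IH linX scalerA exprS.
Qed.

Lemma reduced_casimir_iter b : reduced_casimir (iter b X u) =
  iter b X (reduced_casimir u) +
  iter_coef b *: iter b.-1 X (right_raise (twist u)).
Proof.
have Q0 : - s ^+ 2 != 0 by rewrite oppr_eq0 expf_neq0.
elim: b => [|b IH].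
  by rewrite /iter_coef expr0 subrr !mul0r scale0r addr0.
have Kb : K (iter b X u) = (s ^+ b * h) *: iter b X u.
  by rewrite (iterX_lin (f := K) b (ospKX h12)) Ku iter_scale scalerA.
have Rb : right_raise (twist (iter b X u)) =
    (- s ^- 2) ^+ b *: iter b X (right_raise (twist u)).
  pose f : {linear V -> V} := right_raise \o twist.
  exact: (iterX_lin (f := f) b right_raiseX).
have XR : iter_coef b *: X (iter b.-1 X (right_raise (twist u)))
    = iter_coef b *: iter b X (right_raise (twist u)).
  by case: b {IH Kb Rb} => // ; rewrite /iter_coef expr0 subrr !mul0r !scale0r.
rewrite [in LHS]iterS casimir_raise IH linear1 XR.
have RZ x p : right_raise (twist (x *: p)) = x *: right_raise (twist p).
  by rewrite !linearZ.
rewrite !(Kb, linX) !scalerA -scalerBl RZ Rb [b.+1.-1]/= -iterS.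
have -> : (- s ^- 2) ^+ b = (Q b)^-1 by rewrite -invrN exprVn.
have E4 : s ^+ b ^+ 4 = Q b ^+ 2.
  by rewrite [in RHS]exprAC sqrrN -[in RHS](exprM s 2 2) exprAC.
have -> : g * (s ^+ b * h * (s ^+ b * h) * (s ^+ b * h)) * (s ^+ b * h)
    = g * h ^+ 4 * Q b ^+ 2.
  by rewrite -E4; ring.
have Qb0 := expf_neq0 b Q0.
lmod F; first by ring.
rewrite /iter_coef (exprS _ b); move: (Q b) Qb0 => z z0.
by field; rewrite z0 Q0 g0 s0 ss1 addrC s2_neqN1.
Qed.

Lemma three_term_iter b : exists A, reduced_casimir (iter b X u) =
  (raise_coef + iter_coef b * right_raise_coef2) *: iter b.+1 X w
  + A *: iter b X u + (iter_coef b * right_raise_coef0) *: iter b.-1 X u'.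
Proof.
have [x Ex] := reduced_casimir_u; have [y Ey] := right_raise_u.
exists (x + iter_coef b * y).
rewrite reduced_casimir_iter Ex Ey iter_linear2 iter_linear3 -!iterSr.
case: b => [|b]; last by lmod F; ring.
by rewrite /iter_coef expr0 subrr !mul0r; lmod F; ring.
Qed.

(** Two sources contribute to X^{b+1} w. Only their sum factors in this way, which makes its
    non-vanishing visible. *)
Lemma raise_coefE b : raise_coef + iter_coef b * right_raise_coef2 =
  (s ^+ 2 + h ^+ 4 * Q b) * (g - (g * Q b)^-1) * s ^+ 2 * h ^+ 2
    / ((h ^+ 4 - s ^+ 4) * (h ^+ 4 + s ^+ 2)).
Proof.
have Q0 : Q b != 0 by rewrite expf_neq0 // oppr_eq0 expf_neq0.
rewrite /raise_coef /iter_coef /right_raise_coef2; move: (Q b) Q0 => z z0.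
by field; rewrite h4Ns h4s' z0 g0 s0 ss1 addrC s2_neqN1.
Qed.

Lemma raise_coef_neq0 b : s ^+ 2 + h ^+ 4 * Q b != 0 -> g ^+ 2 * Q b != 1 ->
  raise_coef + iter_coef b * right_raise_coef2 != 0.
Proof.
move=> n1 n2; have Q0 : Q b != 0 by rewrite expf_neq0 // oppr_eq0 expf_neq0.
rewrite raise_coefE; do ![apply: mulf_neq0 => //]; rewrite ?expf_neq0 //.
  apply: contra n2; rewrite subr_eq0 => /eqP E.
  by rewrite expr2 -mulrA {1}E mulVf ?mulf_neq0.
by rewrite invr_neq0 // mulf_neq0.
Qed.

Lemma iter_coef_neq0 b :
  Q b != 1 -> g ^+ 2 * h ^+ 4 * Q b != - s ^+ 2 -> iter_coef b != 0.
Proof.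
move=> n1 n2; have Q0 : Q b != 0 by rewrite expf_neq0 // oppr_eq0 expf_neq0.
have s21 : s - s^-1 != 0.
  apply: contra ss1; rewrite subr_eq0 => /eqP E.
  by rewrite {1}E mulVf // subrr.
rewrite /iter_coef mulf_neq0 //.
  rewrite mulf_neq0 ?invr_neq0 ?mulf_neq0 //; first by rewrite subr_eq0 eq_sym.
  by rewrite addrC s2_neqN1.
apply: contra n2; rewrite subr_eq0 => /eqP E; apply/eqP.
have -> : g ^+ 2 * h ^+ 4 * Q b = g * h ^+ 4 * (g * Q b) by ring.
by rewrite -E divfK // mulf_neq0.
Qed.

Lemma right_raise_coef0_neq0 :
  (h ^+ 4 + s ^+ 2) * (G ^+ 2 - G ^- 2) +
    (s ^+ 2 - s ^- 2) * s * h ^+ 2 * d != 0 ->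
  right_raise_coef0 != 0.
Proof.
move=> n; rewrite /right_raise_coef0 mulNr oppr_eq0 mulf_neq0 //.
  by rewrite mulf_neq0 ?invr_neq0.
by apply: contra n => /eqP E; rewrite -[X in X + _]mulrC -(divfK h4Ns (_ * d))
  -mulrDl E mul0r.
Qed.

(** When h and d come from a vector X^a phi, both are expressed through M and q^a, and the critical
    bracket factors just as [lowest_coef] does, again because (-1)^a squares to 1. *)
Lemma right_raise_coef0_neq0_lowest M a :
  M != 0 -> h ^+ 2 = M * s * s ^+ 2 ^+ a * G ^+ 2 -> d = lowest_coef s M a ->
  (s ^+ 2 ^+ a * G ^+ 4) ^+ 2 != 1 ->
  (M ^+ 2 * s ^+ 2 ^+ a * G ^+ 4) ^+ 2 != 1 -> right_raise_coef0 != 0.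
Proof.
move=> M0 hE dE n1 n2; apply: right_raise_coef0_neq0.
have t0 : s ^+ 2 ^+ a != 0 by rewrite !expf_neq0.
have e2 : (-1) ^+ a ^+ 2 = 1 :> F by rewrite exprAC sqrrN !expr1n.
rewrite (exprM h 2 2) hE dE /lowest_coef exprVn.
move: (s ^+ 2 ^+ a) t0 n1 n2 ((-1) ^+ a) e2 => t t0 n1 n2 e e2.
have -> : ((M * s * t * G ^+ 2) ^+ 2 + s ^+ 2) * (G ^+ 2 - G ^- 2)
    + (s ^+ 2 - s ^- 2) * s * (M * s * t * G ^+ 2)
      * ((M * (t - e) - M^-1 * (t^-1 - e)) / (s ^+ 2 - s ^- 2))
  = s ^+ 2 / G ^+ 2 * ((t * G ^+ 4 - e) * (M ^+ 2 * t * G ^+ 4 + e) + (e ^+ 2 -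
    1)).
  by field; rewrite M0 t0 G0 s0 -!expr2 -!exprM s41.
rewrite e2 subrr addr0 !mulf_neq0 ?invr_neq0 ?expf_neq0 //.
  by apply: contra n1; rewrite subr_eq0 => /eqP ->; rewrite e2.
by apply: contra n2; rewrite addr_eq0 => /eqP ->; rewrite sqrrN e2.
Qed.

End Step.
End TwoFactors.

(** * Restriction of the Casimir operator *)

Section ThreeFactors.
Variables (F : fieldType) (V : lmodType F) (s : F).
Hypotheses (s0 : s != 0) (s4 : s ^+ 4 != 1).
Variables (r1 r2 r3 : ops V).
Hypotheses (h1 : osp_ops s r1) (h2 : osp_ops s r2) (h3 : osp_ops s r3).
Hypotheses (c12 : commuting r1 r2) (c23 : commuting r2 r3).
Variables (rho : {linear V -> V}) (G : F) (G0 : G != 0).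
Hypothesis rho_r1 : forall x p, rho (r1 x p) = r1 x (rho p).
Hypothesis rho_r2 : forall x p, rho (r2 x p) = r2 x (rho p).
Hypothesis rhoX : forall p, rho (r3 genAp p) = 0.
Hypothesis rhoK : forall p, rho (r3 genK p) = G *: rho p.
Hypothesis rhoP : forall p, rho (r3 genP p) = rho p.

(** All operators of the third factor restrict well except its lowering operator. Restricting the
    hypothesis and inverting K^{-1} on the first two factors solves for it. *)
Lemma rho_casimir y : coprod (coprod r1 r2) r3 genAm y = 0 ->
  rho (casimir_op s (coprod r2 r3) y) =
  reduced_casimir s r1 r2 (G ^+ 2) (rho y).
Proof.
move=> Dy0.
have rhoD : rho (r3 genAm y) = - G *: coprod r1 r2 genK (coprod r1 r2 genAm
  (rho y)).
  have h12 := coprod_osp s0 s4 h1 h2 c12.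
  have : coprod r1 r2 genK (rho (coprod (coprod r1 r2) r3 genAm y)) = 0.
    by rewrite Dy0 !linear0.
  have rho_12 x p : rho (coprod r1 r2 x p) = coprod r1 r2 x (rho p).
    by case: x => /=; rewrite ?linearD ?rho_r1 ?rho_r2.
  have -> : coprod (coprod r1 r2) r3 genAm y =
    coprod r1 r2 genAm (r3 genK (r3 genP y)) + coprod r1 r2 genKinv (r3 genAm
      y).
    by [].
  rewrite linearD !rho_12 rhoK rhoP linearD (ospKK' h12) !linearZ /= => /eqP.
  by rewrite addrC addr_eq0 scaleNr => /eqP.
have rhoK' p : rho (r3 genKinv p) = G^-1 *: rho p.
  by rewrite -[in RHS](ospKK' h3 p) rhoK scalerA mulVf // scale1r.
have rhoDK p : rho (r3 genAm (r3 genK p)) = (s * G) *: rho (r3 genAm p).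
  by rewrite -[r3 genAm (r3 genK p)](scalerKV s0) -(ospKD h3) linearZ /= rhoK
    scalerA.
rewrite /casimir_op /= !(linE r2, linE r3, c23, ospE h2, ospE h3) /=.
have rhoA u v : rho (u + v) = rho u + rho v by rewrite linearD.
have rhoN u : rho (- u) = - rho u by rewrite linearN.
have rhoZ a u : rho (a *: u) = a *: rho u by rewrite linearZ.
rewrite !(rhoA, rhoN, rhoZ).
rewrite !(rho_r2, rhoX, rhoK, rhoK', rhoP, rhoDK, rhoD).
rewrite /reduced_casimir /twist /= !linear0 ?(linE r1, linE r2, c12, ospE h1,
  ospE h2) /=.
have ss1 : s * s - 1 != 0 by rewrite -expr2 s2_neq1.
lmod F.
all: try (field; rewrite ?s0 ?G0 ?ss1 -?expr2 -?exprM ?(s4_sub1 s4) //).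
Qed.

End ThreeFactors.

(** * Polynomials and Cauchy-Kovalevskaya extensions *)

Section Polynomials.
Variables (R : realFieldType) (F : fieldType) (n : nat).
Variables (q : F) (qpow : R -> F) (mu : 'I_n.+1 -> R).
Local Notation Pol := {mpoly F[n.+1]}.
Local Notation VPol := (mpoly_mpoly__canonical__GRing_Lmodule n.+1 F).
Hypothesis qpowD : forall a b, qpow (a + b) = qpow a * qpow b.
Hypothesis qpow1 : qpow 1 = q.
Hypothesis q_neq0 : q != 0.
Hypothesis qpow_sqr : forall a, a != 0 -> qpow a ^+ 2 != 1.
Hypothesis mu_gt0 : forall i, 0 < mu i.

Local Notation s := (qpow 2^-1).
Local Notation real := (realization q qpow mu).
Local Notation gam := (gamma mu).

HB.instance Definition _ x :=
  GRing.isLinear.Build F Pol Pol *:%R (real x)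
    (fun c u v => realization_linear q qpow mu x c u v).

Definition var_ops (i : 'I_n.+1) : ops VPol := fun g => real (i, g).

(** The iterated coproduct on the first j factors. Unlike D_{[j]} and X_{[j]} it omits the
    reflections in later variables, hence commutes with every operator on later factors. *)
Fixpoint head_ops (j : nat) : ops VPol :=
  if j is j'.+1 then coprod (head_ops j') (var_ops (inord j')) else
    @trivial_ops F VPol.

Lemma head_opsK j p :
  head_ops j.+1 genK p = head_ops j genK (var_ops (inord j) genK p).
Proof. by []. Qed.

Lemma head_opsK' j p :
  head_ops j.+1 genKinv p = head_ops j genKinv (var_ops (inord j) genKinv p).
Proof. by []. Qed.

Lemma head_opsP j p :
  head_ops j.+1 genP p = head_ops j genP (var_ops (inord j) genP p).
Proof. by []. Qed.

Lemma head_opsD j p : head_ops j.+1 genAm p =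
  head_ops j genAm (var_ops (inord j) genK (var_ops (inord j) genP p))
  + head_ops j genKinv (var_ops (inord j) genAm p).
Proof. by []. Qed.

Lemma head_opsX j p : head_ops j.+1 genAp p =
  head_ops j genAp (var_ops (inord j) genK (var_ops (inord j) genP p))
  + head_ops j genKinv (var_ops (inord j) genAp p).
Proof. by []. Qed.

Definition head_opsE := (head_opsK, head_opsK', head_opsP, head_opsD,
  head_opsX).

Let qpow_n0 a : qpow a != 0 := qpow_neq0 qpowD qpow1 q_neq0 a.
Let qpow_0 : qpow 0 = 1 := qpow0 qpowD qpow1 q_neq0.
Let qpow_N a : qpow (- a) = (qpow a)^-1 := qpowN qpowD qpow1 q_neq0 a.

Lemma q_sqrt : q = s ^+ 2.
Proof. by rewrite expr2 -qpowD -qpow1; congr qpow; field. Qed.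

Lemma qpow_natM a (k : nat) : qpow (a * k%:R) = qpow a ^+ k.
Proof.
elim: k => [|k IH]; first by rewrite mulr0.
by rewrite mulrSr mulrDr mulr1 qpowD IH exprSr.
Qed.

Lemma s4_neq1 : s ^+ 4 != 1.
Proof. by rewrite (exprM s 2 2) -q_sqrt -qpow1 qpow_sqr ?oner_neq0. Qed.

Lemma s_neq0 : s != 0. Proof. exact: qpow_n0. Qed.

Lemma var_osp i : osp_ops s (var_ops i).
Proof.
have q2 : q ^+ 2 != 1 by rewrite q_sqrt -exprM s4_neq1.
have rel a b := @realization_osp_rel R F n q qpow mu qpowD qpow1 q_neq0 q2 i a
  b.
have s0 := s_neq0.
pose X := var_ops i genAp; pose D := var_ops i genAm; pose P := var_ops i genP.
pose K := var_ops i genK; pose K' := var_ops i genKinv.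
have K'K p : K' (K p) = p.
  by rewrite -[RHS]scale1r; exact: (rel _ _ (osp_KinvK qpow) p).
have KK' p : K (K' p) = p.
  by rewrite -[RHS]scale1r; exact: (rel _ _ (osp_KKinv qpow) p).
have KX p : K (X (K' p)) = s *: X p by exact: (rel _ _ (osp_KAp qpow) p).
have KD p : K (D (K' p)) = s^-1 *: D p.
  by rewrite -qpow_N; exact: (rel _ _ (osp_KAm qpow) p).
have XD p : X (D p) + D (X p) =
    (s - s^-1)^-1 *: (K (K p) + (-1) *: K' (K' p)).
  by rewrite -qpow_N; exact: (rel _ _ (osp_ApAm qpow) p).
have PX p : P (X p) + X (P p) = 0.
  by rewrite -[RHS](scale0r p); exact: (rel _ _ (osp_PAp qpow) p).
have PD p : P (D p) + D (P p) = 0.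
  by rewrite -[RHS](scale0r p); exact: (rel _ _ (osp_PAm qpow) p).
have PK p : P (K p) = K (P p) by exact: (rel _ _ (osp_PK qpow) p).
have PK' p : P (K' p) = K' (P p) by exact: (rel _ _ (osp_PKinv qpow) p).
have PP p : P (P p) = p.
  by rewrite -[RHS]scale1r; exact: (rel _ _ (osp_PP qpow) p).
split => // p.
- by rewrite -[X in X = _]/(K (X p)) -{1}(K'K p) KX.
- by rewrite -[X in X = _]/(K (D p)) -{1}(K'K p) KD.
- rewrite -[X in X = _]/(K' (X p)) -[RHS](K'K) -[in RHS]/(X _) -[in RHS]/(K' p).
  by rewrite (opsZ (var_ops i) genK : forall a u,
    K (a *: u) = a *: K u) KX scalerA mulVf // scale1r.
- rewrite -[X in X = _]/(K' (D p)) -[RHS](K'K) -[in RHS]/(D _) -[in RHS]/(K' p).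
  by rewrite (opsZ (var_ops i) genK : forall a u,
    K (a *: u) = a *: K u) KD scalerA mulfV // scale1r.
- transitivity (- X (D p) + (X (D p) + D (X p))); first by rewrite addKr.
  by rewrite XD scaleN1r.
- by apply/eqP; rewrite -addr_eq0; apply/eqP; exact: PX.
- by apply/eqP; rewrite -addr_eq0; apply/eqP; exact: PD.
Qed.

Lemma var_commuting i j : i != j -> commuting (var_ops i) (var_ops j).
Proof.
move=> ij g h p; apply/esym.
have q2 : q ^+ 2 != 1 by rewrite q_sqrt -exprM s4_neq1.
exact: (act_osp_tensor_eq mu qpowD qpow1 q_neq0 q2
  (pres_rel (osp_comm qpow g h ij)) p).
Qed.

Lemma head_commuting j (i : 'I_n.+1) : (j <= i)%N -> commuting (head_ops j)
  (var_ops i).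
Proof.
elim: j => [|j IH] ji; first exact: commuting_trivial.
apply: commuting_coprod; first exact: IH (ltnW ji).
apply: var_commuting; apply/eqP => E; have jn := leq_trans ji (ltnW (ltn_ord
  i)).
by move: ji; rewrite -E inordK ?ltnn.
Qed.

Lemma head_osp j : (j <= n.+1)%N -> osp_ops s (head_ops j).
Proof.
elim: j => [|j IH] jn; first exact: trivial_osp.
apply: coprod_osp; [exact: s_neq0|exact: s4_neq1|exact: IH (ltnW jn)|exact:
  var_osp|].
by apply: head_commuting; rewrite inordK.
Qed.

(** * Homogeneous polynomials in the first variables *)

Definition shift_deg g k :=
  match g with genAp => k.+1 | genAm => k.-1 | _ => k end.

(** The zero polynomial belongs to every degree; therefore lowering in degree 0, where [shift_deg]
    stays at 0, needs no exception. *)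
Definition hpoly (j k : nat) (p : Pol) := forall m, p@_m != 0 ->
  mdeg m = k /\ forall l : 'I_n.+1, (j <= l)%N -> m l = 0%N.

Lemma hpoly0 j k : hpoly j k 0.
Proof. by move=> m; rewrite mcoeff0 eqxx. Qed.

Lemma hpolyD j k p p' : hpoly j k p -> hpoly j k p' -> hpoly j k (p + p').
Proof.
move=> hp hp' m; rewrite mcoeffD.
by case: (eqVneq p@_m 0) => [->|/hp//]; rewrite add0r => /hp'.
Qed.

Lemma hpolyZ j k c p : hpoly j k p -> hpoly j k (c *: p).
Proof. by move=> hp m; rewrite mcoeffZ mulf_eq0 negb_or => /andP[_ /hp]. Qed.

Lemma hpoly_sum j k (I : Type) (r : seq I) (P : pred I) (f : I -> Pol) :
  (forall i, P i -> hpoly j k (f i)) -> hpoly j k (\sum_(i <- r | P i) f i).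
Proof. by move=> hf; elim/big_ind: _ => //; [exact: hpoly0|exact: hpolyD]. Qed.

Lemma hpoly_widen j j' k p : (j <= j')%N -> hpoly j k p -> hpoly j' k p.
Proof.
by move=> jj' hp m /hp[mk ml]; split=> // l jl; apply: ml; exact: leq_trans jl.
Qed.

Lemma hpoly1 j : hpoly j 0 1.
Proof.
move=> m; rewrite mcoeff1; have [->|_] := eqVneq m 0%MM; last by rewrite eqxx.
by rewrite mdeg0; split=> // l _; rewrite mnm0E.
Qed.

Lemma hpoly_var j k (i : 'I_n.+1) g p :
  (i < j)%N -> hpoly j k p -> hpoly j (shift_deg g k) (var_ops i g p).
Proof.
move=> ij hp m.
have diag c : c * p@_m != 0 ->
    mdeg m = k /\ forall l : 'I_n.+1, (j <= l)%N -> m l = 0%N.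
  by rewrite mulf_eq0 negb_or => /andP[_ /hp].
case: g; rewrite /var_ops [_@__]/=.
- rewrite mcoeff_XM; have [|nz] := eqVneq (m i) 0%N; first by rewrite eqxx.
  move=> /hp[mk ml]; have le : (U_(i) <= m)%MM by rewrite lep1mP.
  split=> [|l jl]; first by rewrite -(submK le) mdegD mdeg1 mk addn1.
  have := ml _ jl; rewrite mnmBE mnm1E; have [E|_] := eqVneq i l;
    last by rewrite subn0.
  by move: ij; rewrite E ltnNge jl.
- rewrite mcoeff_Dq mulf_eq0 negb_or => /andP[_ /hp[mk ml]].
  split=> [|l jl]; first by rewrite /= -mk mdegD mdeg1 addn1.
  by have /eqP := ml _ jl; rewrite mnmDE addn_eq0 => /andP[/eqP].
- by rewrite mcoeff_Kq => /diag.
- by rewrite mcoeff_Kqinv => /diag.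
- by rewrite mcoeff_reflx => /diag.
Qed.

Arguments hpoly_var [j k i] g [p].

Lemma var_lower_hpoly0 j (i : 'I_n.+1) p : hpoly j 0 p -> var_ops i genAm p = 0.
Proof.
move=> hp; apply/mpolyP => m; rewrite mcoeff0 [_@__]mcoeff_Dq.
have [->|/hp[]] := eqVneq p@_(m + U_(i)) 0; first by rewrite mulr0.
by rewrite mdegD mdeg1 addn1.
Qed.

Lemma hpoly_head j i k g p : (i <= j)%N -> (j <= n.+1)%N ->
  hpoly j k p -> hpoly j (shift_deg g k) (head_ops i g p).
Proof.
move=> ij jn; elim: i ij k g p => [|i IH] ij k g p hp.
  by case: g => //; exact: hpoly0.
have ii : (@inord n i < j)%N by rewrite inordK // (leq_trans ij).
have {}IH k' g' p' := IH (ltnW ij) k' g' p'.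
have hK := hpoly_var genK ii hp; have hP := hpoly_var genP ii hp.
case: g; rewrite head_opsE.
- apply: hpolyD; first exact: (IH _ genAp _ (hpoly_var genK ii hP)).
  exact: (IH _ genKinv _ (hpoly_var genAp ii hp)).
- apply: hpolyD; first exact: (IH _ genAm _ (hpoly_var genK ii hP)).
  exact: (IH _ genKinv _ (hpoly_var genAm ii hp)).
- exact: (IH _ genK _ hK).
- exact: (IH _ genKinv _ (hpoly_var genKinv ii hp)).
- exact: (IH _ genP _ hP).
Qed.

Lemma head_lower_hpoly0 j i p : (i <= j)%N -> (j <= n.+1)%N ->
  hpoly j 0 p -> head_ops i genAm p = 0.
Proof.
move=> ij jn; elim: i ij p => [|i IH] ij p hp; first by [].
rewrite head_opsE.
have ii : (@inord n i < j)%N by rewrite inordK // (leq_trans ij).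
rewrite (var_lower_hpoly0 _ hp) linear0 addr0; apply: IH; first exact: ltnW.
exact: (hpoly_var genK ii (hpoly_var genP ii hp)).
Qed.

Lemma ltn_split_inord j (l : 'I_n.+1) : (j < n.+1)%N ->
  ((l < j.+1) && (l != inord j))%N = (l < j)%N.
Proof.
by move=> jn; rewrite -val_eqE /= inordK // ltnS [RHS]ltn_neqAle andbC.
Qed.

Lemma gamma_sumS j : (j < n.+1)%N ->
  gamma_sum mu j.+1 = gam (inord j) + gamma_sum mu j.
Proof.
move=> jn; rewrite /gamma_sum (bigD1 (inord j)) /=; last by rewrite inordK.
by congr (_ + _); apply: eq_bigl => l; rewrite ltn_split_inord.
Qed.

Lemma mcoeff_head_K j (p : Pol) m : (j <= n.+1)%N ->
  (head_ops j genK p)@_m =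
  qpow ((gamma_sum mu j + (\sum_(l < n.+1 | (l < j)%N) m l)%:R) / 2) * p@_m.
Proof.
elim: j p => [|j IH] p jn.
  by rewrite /gamma_sum !big_pred0 // addr0 mul0r qpow_0 mul1r.
rewrite head_opsK IH ?(ltnW jn) // [(var_ops _ _ _)@__]mcoeff_Kq.
rewrite mulrA -qpow_natM -!qpowD; congr (qpow _ * _).
rewrite gamma_sumS // [in RHS](bigD1 (inord j)) /=; last by rewrite inordK.
by rewrite [in RHS](eq_bigl _ _ (fun l => ltn_split_inord l jn)) natrD; field.
Qed.

Lemma head_K_hpoly j k p : (j <= n.+1)%N -> hpoly j k p ->
  head_ops j genK p = qpow ((gamma_sum mu j + k%:R) / 2) *: p.
Proof.
move=> jn hp; apply/mpolyP => m; rewrite mcoeff_head_K // mcoeffZ.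
have [->|/hp[mk ml]] := eqVneq p@_m 0; first by rewrite !mulr0.
suff -> : \sum_(l < n.+1 | (l < j)%N) m l = k by [].
rewrite -mk mdegE [RHS](bigID (fun l : 'I_n.+1 => (l < j)%N)) /=.
by rewrite [X in (_ + X)%N]big1 ?addn0 // => l; rewrite -leqNgt => /ml.
Qed.

(* For a = 0 this is restriction to x_{i+1} = 0. *)
Definition slice (i : 'I_n.+1) (a : nat) (p : Pol) : Pol :=
  \sum_(m <- msupp p | m i == a) p@_m *: 'X_[m].

Lemma mcoeff_slice i a p m : (slice i a p)@_m = (m i == a)%:R * p@_m.
Proof.
rewrite /slice raddf_sum /=.
under eq_bigr do rewrite mcoeffZ mcoeffX.
have [m_in|m_out] := boolP (m \in msupp p).
  rewrite big_mkcond (bigD1_seq _ m_in (msupp_uniq p)) /= eqxx mulr1.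
  rewrite big1 => [|m' /negPf ->]; last by rewrite mulr0 if_same.
  by case: eqP; rewrite addr0 ?mul1r ?mul0r.
rewrite (memN_msupp_eq0 m_out) mulr0 big_seq_cond big1 // => m' /andP[m'_in _].
by case: eqP m'_in => [->|_ _]; rewrite ?(negPf m_out) ?mulr0.
Qed.

Lemma slice_linear i a : linear (slice i a).
Proof.
move=> c u v; apply/mpolyP => m.
by rewrite !(mcoeffD, mcoeffZ, mcoeff_slice) mulrDr mulrCA.
Qed.

HB.instance Definition _ i a :=
  GRing.isLinear.Build F VPol VPol *:%R (slice i a) (@slice_linear i a).

Lemma sliceD i a u v : slice i a (u + v) = slice i a u + slice i a v.
Proof. exact: linearD. Qed.

Lemma sliceZ i a c u : slice i a (c *: u) = c *: slice i a u.
Proof. exact: linearZ. Qed.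

Lemma sliceB i a u v : slice i a (u - v) = slice i a u - slice i a v.
Proof. exact: linearB. Qed.

Lemma slice_var i a l g p : l != i ->
  slice i a (var_ops l g p) = var_ops l g (slice i a p).
Proof.
move=> li; have [c [x [y E]]] := mcoeff_realization q qpow mu l g.
apply/mpolyP => m; rewrite mcoeff_slice [(var_ops _ _ _)@__]E [RHS]E
  mcoeff_slice.
rewrite mulrCA; congr (_ * ((_ == _)%:R * _)).
by rewrite mnmBE mnmDE !mulmnE mnm1E (negPf li) !mul0n addn0 subn0.
Qed.

Lemma slice_head (i : 'I_n.+1) a j g p : (j <= i)%N ->
  slice i a (head_ops j g p) = head_ops j g (slice i a p).
Proof.
elim: j g p => [|j IH] g p ji; first by case: g => //=; rewrite linear0.
have jn := leq_trans ji (ltnW (ltn_ord i)).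
have ne : inord j != i.
  by apply/eqP => E; move: ji; rewrite -E inordK ?ltnn.
have {}IH g' p' := IH g' p' (ltnW ji).
by case: g; rewrite !head_opsE ?sliceD !(IH, slice_var _ _ _ ne).
Qed.

Lemma slice_K i a p :
  slice i a (var_ops i genK p) = (qpow (gam i / 2) * s ^+ a) *: slice i a p.
Proof.
apply/mpolyP => m; rewrite mcoeffZ !mcoeff_slice [(var_ops _ _ _)@__]mcoeff_Kq.
by case: eqP => [->|_]; rewrite ?mul1r ?mul0r ?mulr0.
Qed.

Lemma slice_P i a p : slice i a (var_ops i genP p) = (-1) ^+ a *: slice i a p.
Proof.
apply/mpolyP => m; rewrite mcoeffZ !mcoeff_slice [(var_ops _ _
  _)@__]mcoeff_reflx.
by case: eqP => [->|_]; rewrite ?mul1r ?mul0r ?mulr0.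
Qed.

Lemma slice_X0 i p : slice i 0 (var_ops i genAp p) = 0.
Proof.
apply/mpolyP => m; rewrite mcoeff0 mcoeff_slice [(var_ops _ _ _)@__]mcoeff_XM.
by case: eqP; rewrite ?mulr0 ?mul0r.
Qed.

Lemma slice_hpoly (i : 'I_n.+1) k p : hpoly i k p -> slice i 0 p = p.
Proof.
move=> hp; apply/mpolyP => m; rewrite mcoeff_slice.
by have [->|/hp[_ ->]] := eqVneq p@_m 0; rewrite ?mulr0 ?mul1r.
Qed.

Lemma qbr_muE i a : qbr_mu q qpow mu i a = lowest_coef s (qpow (mu i)) a.
Proof.
have qs := q_sqrt.
have E (b : R) : qpow (b + a%:R) = qpow b * (s ^+ 2) ^+ a.
  by rewrite qpowD -qs -qpow1 -qpow_natM mul1r.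
rewrite /qbr_mu /qbr /lowest_coef -qs !qpow_N E -qs invfM exprVn.
by rewrite mulrA -mulrBl; congr (_ * _); ring.
Qed.

Lemma mcoeff_lower i p m : (var_ops i genAm p)@_m =
  qbr_mu q qpow mu i (m i).+1 * p@_(m + U_(i)).
Proof.
rewrite [(var_ops _ _ _)@__]mcoeff_Dq qbr_muE; congr (_ * _).
rewrite /lowest_coef -q_sqrt !qpow_N qpow1.
by rewrite mulrBl; congr (_ - _); rewrite mulrAC.
Qed.

Lemma qbr_mu_neq0 i a : (0 < a)%N -> qbr_mu q qpow mu i a != 0.
Proof.
move=> a0; have aR : 0 < a%:R :> R by rewrite ltr0n.
have s0 : s != 0 by exact: qpow_n0.
have s4 := s4_neq1.
have E : s ^+ 2 ^+ a = qpow a%:R.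
  by rewrite -q_sqrt -qpow1 -qpow_natM mul1r.
rewrite qbr_muE lowest_coef_neq0 ?E //; first by rewrite qpow_sqr // gt_eqF.
rewrite (expr2 (qpow (mu i))) -!qpowD qpow_sqr // gt_eqF //.
by have := mu_gt0 i; lra.
Qed.

(** Lowering takes the part of exponent a+1 to that of exponent a and multiplies it by
    [mu_i, a+1; q], which is nonzero. *)
Lemma slice_lower i a p :
  slice i a (var_ops i genAm p) = 0 -> slice i a.+1 p = 0.
Proof.
move=> E; apply/mpolyP => m; rewrite mcoeff0 mcoeff_slice.
have [mi|_] := eqVneq (m i) a.+1; last by rewrite mul0r.
have le : (U_(i) <= m)%MM by rewrite lep1mP mi.
have := congr1 (mcoeff (m - U_(i))) E.
rewrite mcoeff0 mcoeff_slice mcoeff_lower submK // mnmBE mnm1E eqxx mi subn1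
  eqxx.
move/eqP; rewrite mul1r mulf_eq0 (negPf (qbr_mu_neq0 _ _)) // => /eqP ->.
by rewrite mulr0.
Qed.

Lemma slice_all0 i p : (forall a, slice i a p = 0) -> p = 0.
Proof.
move=> E; apply/mpolyP => m; have := congr1 (mcoeff m) (E (m i)).
by rewrite mcoeff_slice eqxx mul1r !mcoeff0.
Qed.

(* D_{[i+1]} p = 0 determines the slices of p one after the other. *)
Lemma monogenic_unique i p : (i <= n)%N ->
  head_ops i.+1 genAm p = 0 -> slice (inord i) 0 p = 0 -> p = 0.
Proof.
move=> iN Dp p0; apply: (@slice_all0 (inord i)) => a.
have ii : @inord n i = i :> nat by rewrite inordK.
elim: a => // a IH; apply: slice_lower.
have := congr1 (slice (inord i) a) Dp.
rewrite head_opsE sliceD !slice_head ?ii // slice_K slice_P IH.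
rewrite !scaler0 !linear0 add0r => /(congr1 (head_ops i genK)).
by rewrite linear0 (ospKK' (head_osp (leqW iN))).
Qed.

(** * D_{[j]} and X_{[j]} as iterated coproducts *)

Lemma mcoeff_big_comp (P : pred 'I_n.+1) (f : 'I_n.+1 -> Pol -> Pol)
    (e : 'I_n.+1 -> F) m p :
  (forall l p, (f l p)@_m = e l * p@_m) ->
  ((\big[comp/id]_(l < n.+1 | P l) f l) p)@_m =
  (\prod_(l < n.+1 | P l) e l) * p@_m.
Proof.
move=> fE; elim/big_rec2: _ p => [|l y1 y2 _ IH] p; first by rewrite mul1r.
by rewrite /= fE IH mulrA.
Qed.

Definition Rop_head (j : nat) (i : 'I_n.+1) : Pol -> Pol :=
  (\big[comp/id]_(l < n.+1 | (l < i)%N) Kqinv qpow mu l)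
  \o (\big[comp/id]_(l < n.+1 | (i < l < j)%N) (Kq qpow mu l \o reflx l)).

Local Notation kinv l m := (qpow (- (gam l / 2)) * qpow (- 2^-1) ^+ (m l)).
Local Notation kref l m := (qpow (gam l / 2) * s ^+ m l * (-1) ^+ m l).

Lemma mcoeff_Rop_head j i p m : (Rop_head j i p)@_m =
  (\prod_(l < n.+1 | (l < i)%N) kinv l m)
  * (\prod_(l < n.+1 | (i < l < j)%N) kref l m) * p@_m.
Proof.
have kE l p' : (Kqinv qpow mu l p')@_m = kinv l m * p'@_m.
  by rewrite mcoeff_Kqinv.
have kpE l p' : ((Kq qpow mu l \o reflx l) p')@_m = kref l m * p'@_m.
  by rewrite /= mcoeff_Kq mcoeff_reflx mulrA.
have E1 := mcoeff_big_comp (fun l : 'I_n.+1 => (l < i)%N) _ kE.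
have E2 := mcoeff_big_comp (fun l : 'I_n.+1 => (i < l < j)%N) p kpE.
by rewrite -mulrA -E2; exact: E1.
Qed.

Lemma Rop_hpoly j k i p : hpoly j k p -> Rop qpow mu j i p = Rop_head j i p.
Proof.
move=> hp; suff E : (\big[comp/id]_(l < n.+1 | (j <= l)%N) reflx l) p = p.
  by rewrite /Rop /Rop_head /= E.
apply/mpolyP => m.
have pE l (p' : Pol) : (reflx l p')@_m = (-1) ^+ m l * p'@_m by rewrite
  mcoeff_reflx.
have E := mcoeff_big_comp (fun l : 'I_n.+1 => (j <= l)%N) p pE.
apply: (etrans E).
have [->|/hp[_ ml]] := eqVneq p@_m 0; first by rewrite mulr0.
by rewrite big1 ?mul1r // => l /ml ->.
Qed.

Lemma mcoeff_head_K' j p m : (j <= n.+1)%N ->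
  (head_ops j genKinv p)@_m = (\prod_(l < n.+1 | (l < j)%N) kinv l m) * p@_m.
Proof.
elim: j p => [|j IH] p jn; first by rewrite big_pred0 ?mul1r.
rewrite head_opsE IH ?(ltnW jn) // [(var_ops _ _ _)@__]mcoeff_Kqinv.
rewrite mulrA; congr (_ * _); rewrite mulrC [RHS](bigD1 (inord j)) /=;
  last first.
  by rewrite inordK.
by congr (_ * _); apply: eq_bigl => l; rewrite ltn_split_inord.
Qed.

Lemma Rop_headS j (i : 'I_n.+1) p : (i < j)%N -> (j < n.+1)%N ->
  Rop_head j.+1 i p =
  Rop_head j i (var_ops (inord j) genK (var_ops (inord j) genP p)).
Proof.
move=> ij jn; apply/mpolyP => m; rewrite !mcoeff_Rop_head.
rewrite [(var_ops _ _ _)@__]mcoeff_Kq [(var_ops _ _ _)@__]mcoeff_reflx.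
rewrite [X in _ * X * _](bigD1 (inord j)) /=; last by rewrite inordK // ij /=.
set a := \prod_(_ < _ | (_ < _)%N) _.
have -> : \prod_(l < n.+1 | ((i < l < j.+1)%N && (l != inord j))) kref l m =
    \prod_(l < n.+1 | (i < l < j)%N) kref l m.
  by apply: eq_bigl => l; rewrite -andbA ltn_split_inord.
by ring.
Qed.

(** Induction on j along the coproduct: the new variable contributes the term with K^{-1} on all
    earlier factors, and the older terms acquire K P of the new factor. *)
Lemma sum_var_ops g j p : (g = genAp) + (g = genAm) -> (j <= n.+1)%N ->
  \sum_(i < n.+1 | (i < j)%N) var_ops i g (Rop_head j i p) = head_ops j g p.
Proof.
move=> hg; elim: j p => [|j IH] p jn.
  by rewrite big_pred0 //; case: hg => ->.
have jj : @inord n j = j :> nat by rewrite inordK.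
have -> : head_ops j.+1 g p = head_ops j genKinv (var_ops (inord j) g p)
    + head_ops j g (var_ops (inord j) genK (var_ops (inord j) genP p)).
  by rewrite [RHS]addrC; case: hg => ->; rewrite head_opsE.
rewrite (bigD1 (inord j)) /= ?jj // -IH ?(ltnW jn) //; congr (_ + _).
  rewrite -(head_commuting) ?jj //.
  congr (var_ops _ _ _); apply/mpolyP => m.
  rewrite mcoeff_Rop_head mcoeff_head_K' ?(ltnW jn) // jj.
  rewrite [X in _ * X * _]big_pred0 ?mulr1 // => l.
  by rewrite ltnS; case: ltngtP.
rewrite (eq_bigl (fun i : 'I_n.+1 => (i < j)%N)) => [|i]; last first.
  by rewrite ltn_split_inord.
by apply: eq_bigr => i ij; rewrite Rop_headS.
Qed.

Lemma Dsum_hpoly j k p : (j <= n.+1)%N -> hpoly j k p ->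
  Dsum q qpow mu j p = head_ops j genAm p.
Proof.
move=> jn hp; rewrite -sum_var_ops //; last by right.
by apply: eq_bigr => i _; rewrite (Rop_hpoly _ hp).
Qed.

Lemma Xsum_hpoly j k p : (j <= n.+1)%N -> hpoly j k p ->
  Xsum qpow mu j p = head_ops j genAp p.
Proof.
move=> jn hp; rewrite -sum_var_ops //; last by left.
by apply: eq_bigr => i _; rewrite (Rop_hpoly _ hp).
Qed.

(** * The Cauchy-Kovalevskaya extension *)

Local Notation CK := (CK q qpow mu).
Local Notation I := (@inord n).

Lemma mulX_iter i a (p : Pol) : 'X_i ^+ a * p = iter a (var_ops i genAp) p.
Proof. by elim: a => [|a IH]; rewrite ?mul1r // exprS -mulrA IH. Qed.

Lemma hpoly_iter_raise i j k a p : (i <= j)%N -> (j <= n.+1)%N ->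
  hpoly j k p -> hpoly j (k + a) (iter a (head_ops i genAp) p).
Proof.
move=> ij jn hp; elim: a => [|a IH]; first by rewrite addn0.
by rewrite addnS iterS; exact: (hpoly_head (g := genAp) ij jn IH).
Qed.

Lemma hpoly_iter_lower i j k a p : (i <= j)%N -> (j <= n.+1)%N ->
  hpoly j k p -> hpoly j (k - a) (iter a (head_ops i genAm) p).
Proof.
move=> ij jn hp; elim: a => [|a IH]; first by rewrite subn0.
by rewrite subnS iterS; exact: (hpoly_head (g := genAm) ij jn IH).
Qed.

Lemma hpoly_iter_var (i : 'I_n.+1) j k a p : (i < j)%N ->
  hpoly j k p -> hpoly j (k + a) (iter a (var_ops i genAp) p).
Proof.
move=> ij hp; elim: a => [|a IH]; first by rewrite addn0.
by rewrite addnS iterS; exact: (hpoly_var genAp ij IH).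
Qed.

Section Var.
Variables (i k : nat) (w : Pol).
Hypotheses (iN : (i <= n)%N) (hw : hpoly i k w).

Let Ii : I i = i :> nat. Proof. by rewrite inordK. Qed.
Let wI m : w@_m != 0 -> m (I i) = 0%N.
Proof. by move=> /hw[_]; apply; rewrite Ii. Qed.

Lemma var_K_hpoly : var_ops (I i) genK w = qpow (gam (I i) / 2) *: w.
Proof.
apply/mpolyP => m; rewrite [LHS]mcoeff_Kq mcoeffZ.
by have [->|/wI ->] := eqVneq w@_m 0; rewrite ?mulr0 ?mulr1.
Qed.

Lemma var_P_hpoly : var_ops (I i) genP w = w.
Proof.
apply/mpolyP => m; rewrite [LHS]mcoeff_reflx.
by have [->|/wI ->] := eqVneq w@_m 0; rewrite ?mulr0 ?mul1r.
Qed.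

Lemma var_lower_hpoly : var_ops (I i) genAm w = 0.
Proof.
apply/mpolyP => m; rewrite mcoeff_lower // mcoeff0.
have [->|/wI] := eqVneq w@_(m + U_(I i)) 0; first by rewrite mulr0.
by rewrite mnmDE mnm1E eqxx addn1.
Qed.

(** As w is free of the new variable, it is a lowest weight vector for that factor;
    [lower_iter_raise] gives the second term, and K P in the coproduct gives the scalar of the
    first. *)
Lemma lower_iter_var a : head_ops i.+1 genAm (iter a (var_ops (I i) genAp) w) =
  ((-1) ^+ a * (qpow (gam (I i) / 2) * s ^+ a)) *:
     iter a (var_ops (I i) genAp) (head_ops i genAm w)
  + qbr_mu q qpow mu (I i) a *:
      iter a.-1 (var_ops (I i) genAp) (head_ops i genKinv w).
Proof.
have c g p b : iter b (var_ops (I i) genAp) (head_ops i g p) = head_ops i g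
  (iter b (var_ops (I i) genAp) p).
  by elim: b => // b IH; rewrite !iterS IH head_commuting ?Ii.
rewrite !c head_opsE.
have P_iter : var_ops (I i) genP (iter a (var_ops (I i) genAp) w) =
    (-1) ^+ a *: iter a (var_ops (I i) genAp) w.
  elim: a => [|a IH]; first by rewrite scale1r; exact: var_P_hpoly.
  by rewrite iterS (ospPX (var_osp _)) IH (opsZ (var_ops _)) exprS -scaleNr
    mulN1r.
rewrite P_iter (opsZ (var_ops _)) (iter_raise_K (var_osp _) var_K_hpoly).
rewrite (lower_iter_raise s_neq0 s4_neq1 (var_osp _) (qpow_n0 _)
  var_lower_hpoly var_K_hpoly).
rewrite !(opsZ (head_ops i)) scalerA; congr (_ + _ *: _).
(* The weight is q^{gamma/2}, so M = q^{gamma - 1/2} = q^mu. *)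
rewrite qbr_muE //; congr (lowest_coef _ _ _).
by rewrite expr2 -qpowD -qpow_N -qpowD; congr qpow; rewrite /gamma; field.
Qed.

End Var.

(* The recursion that makes the sum D_{[i+1]} (CK p) telescope. *)
Lemma CK_coefS i k a : (i <= n)%N ->
  let c a := (-1) ^+ ((a * a.+1)./2)%N
       * qpow (a%:R / 2 * (gamma_sum mu i.+1 + k%:R - 1))
       / \prod_(1 <= l < a.+1) qbr_mu q qpow mu (I i) l in
  c a * ((-1) ^+ a * (qpow (gam (I i) / 2) * s ^+ a)) =
  - (c a.+1 * qbr_mu q qpow mu (I i) a.+1
     * qpow (- ((gamma_sum mu i + (k%:R - a.+1%:R)) / 2))).
Proof.
move=> iN c; rewrite {}/c.
have -> : \prod_(1 <= l < a.+2) qbr_mu q qpow mu (I i) l =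
    \prod_(1 <= l < a.+1) qbr_mu q qpow mu (I i) l * qbr_mu q qpow mu (I i)
      a.+1.
  by rewrite big_nat_recr.
have -> : ((a.+1 * a.+2)%N)./2 = ((a * a.+1)./2 + a.+1)%N.
  rewrite (_ : (a.+1 * a.+2) = a * a.+1 + a.+1.*2)%N; last by lia.
  by rewrite halfD doubleK odd_double andbF.
have b0 : qbr_mu q qpow mu (I i) a.+1 != 0.
  exact: qbr_mu_neq0.
rewrite exprD exprS.
have -> : qpow (a.+1%:R / 2 * (gamma_sum mu i.+1 + k%:R - 1)) =
  qpow (a%:R / 2 * (gamma_sum mu i.+1 + k%:R - 1)) * (qpow (gam (I i) / 2) * s
    ^+ a)
  * qpow ((gamma_sum mu i + (k%:R - a.+1%:R)) / 2).
  rewrite -qpow_natM -!qpowD gamma_sumS //; congr qpow.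
  by rewrite -addn1 natrD; field.
rewrite qpow_N.
have p0 := qpow_n0 ((gamma_sum mu i + (k%:R - a.+1%:R)) / 2).
have P0 : \prod_(1 <= l < a.+1) qbr_mu q qpow mu (I i) l != 0.
  rewrite prodf_seq_neq0; apply/allP => l; rewrite mem_index_iota => /andP[l0
    _].
  by rewrite qbr_mu_neq0.
move: (qpow _ * s ^+ a) => t; move: ((-1) ^+ _) ((-1) ^+ a) => e e2.
by field; rewrite p0 P0 b0.
Qed.

Lemma CK_spec i k p : (i <= n)%N -> hpoly i k p ->
  [/\ head_ops i.+1 genAm (CK (I i) k p) = 0, slice (I i) 0 (CK (I i) k p) = p
    & hpoly i.+1 k (CK (I i) k p)].
Proof.
move=> iN hp; have Ii : I i = i :> nat by rewrite inordK.
pose c a := (-1) ^+ ((a * a.+1)./2)%N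
       * qpow (a%:R / 2 * (gamma_sum mu i.+1 + k%:R - 1))
       / \prod_(1 <= l < a.+1) qbr_mu q qpow mu (I i) l.
pose z a := iter a (head_ops i genAm) p.
have hz a : hpoly i (k - a) (z a) by apply: hpoly_iter_lower => //; exact: leqW.
have zE a : iter a (Dsum q qpow mu i) p = z a.
  elim: a => // a IH; by rewrite iterS IH (Dsum_hpoly (leqW iN) (hz a)).
have -> : CK (I i) k p = \sum_(a < k.+1) c a *: iter a (var_ops (I i) genAp) (z
  a).
  by rewrite /Defs.CK Ii; apply: eq_bigr => a _; rewrite mulX_iter zE.
split.
- rewrite linear_sum.
  (* This is the second term of [lower_iter_var] for the summand a; by [CK_coefS] the first one is
     [- f a.+1]. The ends vanish: f 0 because [mu, 0; q] = 0, and [f k.+1] because k+1 lowerings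
     kill degree k. *)
  pose f a := (c a * qbr_mu q qpow mu (I i) a
    * qpow (- ((gamma_sum mu i + (k%:R - a%:R)) / 2))) *:
       iter a.-1 (var_ops (I i) genAp) (z a).
  have E (a : 'I_k.+1) : head_ops i.+1 genAm (c a *: iter a (var_ops (I i)
    genAp) (z a)) =
      - (f a.+1 - f a).
    rewrite (opsZ (head_ops i.+1)) (lower_iter_var iN (hz a)).
    have -> : head_ops i genKinv (z a) =
        qpow (- ((gamma_sum mu i + (k%:R - a%:R)) / 2)) *: z a.
      rewrite -[in RHS](ospK'K (head_osp (leqW iN)) (z a)).
      rewrite (head_K_hpoly (leqW iN) (hz a)) (opsZ (head_ops i)).
      by rewrite natrB -1?ltnS // scalerA -qpowD addNr qpow_0 scale1r.
    have itZ b x u : iter b (var_ops (I i) genAp) (x *: u) =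
        x *: iter b (var_ops (I i) genAp) u.
      by elim: b => // b IH; rewrite !iterS IH (opsZ (var_ops _)).
    rewrite itZ scalerDr !scalerA (CK_coefS k a iN) -/(c a.+1).
    by rewrite scaleNr opprB addrC.
  rewrite (eq_bigr _ (fun a _ => E a)) sumrN.
  rewrite -(big_mkord xpredT (fun a => f a.+1 - f a)) telescope_sumr //.
  have -> : f k.+1 = 0.
    have h0 : hpoly i 0 (z k) by have := hz k; rewrite subnn.
    have zk : z k.+1 = 0 := head_lower_hpoly0 (leqnn i) (leqW iN) h0.
    have it0 b : iter b (var_ops (I i) genAp) 0 = 0.
      by elim: b => // b IH; rewrite iterS IH linear0.
    by rewrite /f zk it0 scaler0.
  have -> : f 0 = 0.
    by rewrite /f qbr_muE // /lowest_coef !expr0 !subrr !mulr0 subrr mul0r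
      mulr0 mul0r scale0r.
  by rewrite subrr oppr0.
- rewrite big_ord_recl sliceD linear_sum big1 => [|a _]; last first.
    rewrite -[LHS]/(slice (I i) 0 _) sliceZ lift0 iterS.
    by rewrite slice_X0 scaler0.
  rewrite addr0 /c mul0r mul0r qpow_0 big_geq // invr1 !mulr1 scale1r.
  by apply: (@slice_hpoly (I i) k); rewrite Ii.
- apply: hpoly_sum => a _; apply: hpolyZ.
  have ii : (I i < i.+1)%N by rewrite Ii.
  have := hpoly_iter_var (a := a) ii (hpoly_widen (leqnSn i) (hz a)).
  by rewrite subnK // leq_ord.
Qed.

Let Iv i : (i <= n)%N -> I i = i :> nat. Proof. by move=> iN;
  rewrite inordK. Qed.
Let Ineq i j : (i < j)%N -> (j <= n)%N -> I i != I j.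
Proof.
move=> ij jn; apply/eqP => /(congr1 val) /=.
by rewrite !Iv ?(leq_trans (ltnW ij)) // => E; move: ij; rewrite E ltnn.
Qed.

(** * The three-term relation *)

(** Both sides are killed by D_{[i+1]}, so it suffices to compare restrictions, and restriction
    undoes CK. *)
Lemma CK_three_term i k (G : {linear VPol -> VPol}) f f1 f2 f3 (B A C : F) :
  (i <= n)%N -> hpoly i k f -> hpoly i k f1 -> hpoly i k f2 -> hpoly i k f3 ->
  (forall p, G (head_ops i.+1 genAm p) = head_ops i.+1 genAm (G p)) ->
  slice (I i) 0 (G (CK (I i) k f)) = B *: f1 + A *: f2 + C *: f3 ->
  G (CK (I i) k f) =
    B *: CK (I i) k f1 + A *: CK (I i) k f2 + C *: CK (I i) k f3.
Proof.
move=> iN /(CK_spec iN)[D0 _ _] /(CK_spec iN)[D1 S1 _] /(CK_spec iN)[D2 S2 _].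
move=> /(CK_spec iN)[D3 S3 _] GD SG; apply/eqP; rewrite -subr_eq0; apply/eqP.
apply: (monogenic_unique iN).
  rewrite linearB (linear3 (head_ops i.+1 genAm)) -GD D0 D1 D2 D3 linear0.
  by rewrite !scaler0 !addr0 subrr.
by rewrite sliceB SG !sliceD !sliceZ S1 S2 S3 subrr.
Qed.

(* Starts from 1 instead of CK_{x_2}(x_1^{j_1}), using
   x_1^{j_1} = X_{[1]}^{j_1} 1; this makes m = 2 a case like the others. *)
Fixpoint partial_psi (j : seq nat) (i : nat) : Pol :=
  if i is i'.+1 then
    CK (I i) (\sum_(l < i) nth 0%N j l)%N
      (iter (nth 0%N j i') (head_ops i genAp) (partial_psi j i'))
  else 1.

Lemma partial_psi_spec j i : (i <= n)%N ->
  hpoly i.+1 (\sum_(l < i) nth 0%N j l)%N (partial_psi j i) /\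
  head_ops i.+1 genAm (partial_psi j i) = 0.
Proof.
elim: i => [|i IH] iN.
  rewrite big_ord0; split; first exact: hpoly1.
  apply: (head_lower_hpoly0 (leqnn 1)) => //; exact: hpoly1.
have [hp _] := IH (ltnW iN).
have h' : hpoly i.+1 (\sum_(l < i.+1) nth 0%N j l)%N
    (iter (nth 0%N j i) (head_ops i.+1 genAp) (partial_psi j i)).
  by rewrite big_ord_recr; apply: hpoly_iter_raise => //; exact: leqW.
by have [D _ H] := CK_spec iN h'.
Qed.

Lemma partial_psiS j i : partial_psi j i.+1 =
  CK (I i.+1) (\sum_(l < i.+1) nth 0%N j l)%N
  (iter (nth 0%N j i) (head_ops i.+1 genAp) (partial_psi j i)).
Proof. by []. Qed.

Lemma psi_rec0 j : psi_rec q qpow mu j 0 =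
  CK (I 1) (nth 0%N j 0) ('X_ord0 ^+ nth 0%N j 0).
Proof. by []. Qed.

Lemma psi_recS j i : psi_rec q qpow mu j i.+1 =
  CK (I i.+2) (\sum_(l < i.+2) nth 0%N j l)%N
    (iter (nth 0%N j i.+1) (Xsum qpow mu i.+2) (psi_rec q qpow mu j i)).
Proof. by []. Qed.

Lemma psi_recE j i : (i < n)%N -> psi_rec q qpow mu j i = partial_psi j i.+1.
Proof.
elim: i => [|i IH] iN.
  rewrite psi_rec0 partial_psiS big_ord1; congr (CK _ _ _).
  elim: (nth 0%N j 0) => [|b IH]; first by rewrite expr0.
  rewrite exprS IH iterS head_opsX.
  have I0 : I 0 = ord0 by apply/val_inj; rewrite /= inordK.
  by rewrite I0 -[LHS]add0r.
have E b k w : hpoly i.+2 k w ->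
    iter b (Xsum qpow mu i.+2) w = iter b (head_ops i.+2 genAp) w.
  move=> hw; elim: b => // b IHb; rewrite !iterS IHb.
  have hb : hpoly i.+2 (k + b) (iter b (head_ops i.+2 genAp) w).
    exact: hpoly_iter_raise (leqnn _) (leqW iN) hw.
  exact: (Xsum_hpoly (leqW iN) hb).
have [hp _] := partial_psi_spec j (ltnW iN).
by rewrite psi_recS IH ?(ltnW iN) // partial_psiS (E _ _ _ hp).
Qed.

Lemma partial_psi_ext j j' i :
  (forall l, (l < i)%N -> nth 0%N j l = nth 0%N j' l) ->
  partial_psi j i = partial_psi j' i.
Proof.
elim: i => // i IH E; rewrite !partial_psiS E // IH => [|l li];
  last by rewrite E // ltnW.
by congr (CK _ _ _); apply: eq_bigr => l _; rewrite E.
Qed.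

Lemma gamma_sum_ge j : (j <= n.+1)%N -> j%:R / 2 <= gamma_sum mu j.
Proof.
elim: j => [|j IH] jn; first by rewrite mul0r /gamma_sum big_pred0.
rewrite gamma_sumS // -addn1 natrD /gamma.
by have := IH (ltnW jn); have := mu_gt0 (I j); lra.
Qed.

Lemma qpow_sqr_neq x z : x != z -> qpow x ^+ 2 != qpow z ^+ 2.
Proof.
move=> xz; have : qpow (x - z) ^+ 2 != 1 by rewrite qpow_sqr // subr_eq0.
apply: contra => /eqP E; apply/eqP.
by rewrite qpowD exprMn E -exprMn -qpowD subrr qpow_0 expr1n.
Qed.

Lemma sqr_neq (x z : F) : x ^+ 2 != z ^+ 2 -> x != z.
Proof. by apply: contra => /eqP ->. Qed.

Lemma sqrt_q : s ^+ 2 = qpow 1.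
Proof. by rewrite qpow1 q_sqrt. Qed.

Lemma sqrt_qX a : s ^+ 2 ^+ a = qpow a%:R.
Proof. by rewrite sqrt_q -qpow_natM mul1r. Qed.

(** * Two adjacent factors; the local [m] is the m of the statement minus 2 *)

Section Pair.
Variables (m : nat).
Hypothesis mN : (m.+2 <= n)%N.

Local Notation r1 := (head_ops m.+1).
Local Notation r2 := (var_ops (I m.+1)).
Local Notation r3 := (var_ops (I m.+2)).
Local Notation r23 := (coprod r2 r3).

Let m1N : (m.+1 <= n)%N. Proof. exact: ltnW. Qed.
Let h1 : osp_ops s r1 := head_osp (leqW m1N).
Let h2 : osp_ops s r2 := var_osp _.
Let h3 : osp_ops s r3 := var_osp _.
Let c12 : commuting r1 r2. Proof. by apply: head_commuting; rewrite Iv. Qed.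
Let c13 : commuting r1 r3. Proof. by apply: head_commuting; rewrite Iv. Qed.
Let c23 : commuting r2 r3. Proof. by apply: var_commuting; apply: Ineq. Qed.

Section LowestVector.
Variables (phi : Pol) (S : nat).
Hypothesis hphi : hpoly m.+1 S phi.
Hypothesis Dphi : head_ops m.+1 genAm phi = 0.

Definition raised a := iter a (r1 genAp) phi.
Definition raised_CK a := CK (I m.+1) (S + a) (raised a).

Let hraised a : hpoly m.+1 (S + a) (raised a).
Proof. exact: (hpoly_iter_raise (leqnn _) (leqW m1N) hphi). Qed.

Let rho : {linear VPol -> VPol} := slice (I m.+1) 0.
(** [G] is the weight of K for the second factor on polynomials free of its variable, and [h a] the
    weight of u_a = [raised_CK a]. [M] is the parameter of [lowest_coef] for phi: the square of its
    weight divided by s. *)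
Let G := qpow (gam (I m.+1) / 2).
Let h a := qpow ((gamma_sum mu m.+2 + (S + a)%:R) / 2).
Let M := qpow (gamma_sum mu m.+1 + S%:R - 2^-1).

(** The conditionals remove the terms in which a predecessor would be taken of 0; they match the
    convention for vectors that are not allowable. *)
Lemma local_three_term a b (g3 : R) : 0 < g3 -> exists B A C,
  [/\ (0 < a)%N -> B != 0, (0 < b)%N -> C != 0 &
    reduced_casimir s r1 r2 (qpow g3)
      (iter b (head_ops m.+2 genAp) (raised_CK a)) =
    (if (0 < a)%N then B else 0) *:
      iter b.+1 (head_ops m.+2 genAp) (raised_CK a.-1)
    + A *: iter b (head_ops m.+2 genAp) (raised_CK a)
    + (if (0 < b)%N then C else 0) *:
      iter b.-1 (head_ops m.+2 genAp) (raised_CK a.+1)].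
Proof.
move=> g3_gt0; pose g := qpow g3; pose d := lowest_coef s M a.
have g0 : g != 0 by exact: qpow_n0.
have G0 : G != 0 by exact: qpow_n0.
have [Du rho_u hu] := CK_spec m1N (@hraised a).
have [Du' rho_u' _] := CK_spec m1N (@hraised a.+1).
have rho_r1 (x : osp_gen) (p : Pol) : rho (r1 x p) = r1 x (rho p) by apply:
  slice_head; rewrite Iv.
have rhoX (p : Pol) : rho (r2 genAp p) = 0 by exact: slice_X0.
have rhoK (p : Pol) : rho (r2 genK p) = G *: rho p
  by rewrite [LHS]slice_K mulr1.
have rhoP (p : Pol) : rho (r2 genP p) = rho p by rewrite [LHS]slice_P scale1r.
have inj (p : Pol) : coprod r1 r2 genAm p = 0 -> rho p = 0 -> p = 0
  by exact: (@monogenic_unique m.+1 p m1N).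
pose h1' := qpow ((gamma_sum mu m.+1 + S%:R) / 2).
have h1'0 : h1' != 0 by exact: qpow_n0.
have Kphi : r1 genK phi = h1' *: phi.
  exact: (head_K_hpoly (leqW m1N) hphi).
have ME : h1' ^+ 2 / s = M.
  by rewrite expr2 -qpow_N -!qpowD; congr qpow; field.
have Kv : r1 genK (raised a) = (h a / G) *: raised a.
  rewrite (head_K_hpoly (leqW m1N) (@hraised a)); congr (_ *: _).
  by rewrite /h /G -qpow_N -qpowD; congr qpow;
    rewrite (gamma_sumS (j := m.+1)) //; field.
have Dv : r1 genAm (raised a) = d *: raised a.-1.
  by rewrite (lower_iter_raise s_neq0 s4_neq1 h1 h1'0 Dphi Kphi) ME.
have d0 : a = 0%N -> d = 0.
  by rewrite /d => ->; rewrite /lowest_coef !expr0 !subrr !mulr0 subrr mul0r.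
have XDv : r1 genAp (r1 genAm (raised a)) = d *: raised a.
  rewrite Dv (opsZ r1); case: (a) d0 => [/(_ erefl) ->|//].
  by rewrite !scale0r.
pose y := gamma_sum mu m.+2 + (S + a)%:R.
(* At least two gamma_i, each above 1/2, enter y. With h^4 = q^{2y} and s^4 = q^2, this bound keeps
   the denominators of [three_term_iter] nonzero. *)
have y_gt1 : 1 < y.
  have gm := gamma_sum_ge (leqW m1N).
  have E : m.+1%:R = m%:R + 1 :> R by rewrite natr1.
  rewrite /y (gamma_sumS (j := m.+1)) // /gamma.
  have := mu_gt0 (I m.+1); have := ler0n R (S + a); have := ler0n R m.
  lra.
have h0 : h a != 0 by exact: qpow_n0.
have h4E : h a ^+ 4 = qpow y ^+ 2.
  by rewrite /h (exprM _ 2 2) (expr2 (qpow (y / 2))) -qpowD;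
    congr (qpow _ ^+ 2); field.
have qpow2 x : qpow x ^+ 2 = qpow (x * 2).
  by rewrite qpow_natM.
have h4 : h a ^+ 4 != 1 by rewrite h4E qpow_sqr // gt_eqF //; lra.
have h4s : h a ^+ 4 != s ^+ 4.
  by rewrite h4E (exprM s 2 2) sqrt_q qpow_sqr_neq // gt_eqF.
have h4Ns : h a ^+ 4 + s ^+ 2 != 0.
  rewrite addr_eq0 sqr_neq // sqrrN h4E qpow2 sqrt_q qpow_sqr_neq //.
  by rewrite gt_eqF //; lra.
have [A EA] := three_term_iter s_neq0 s4_neq1 h1 h2 c12 g0 G0 rho_r1 rhoX rhoK
  rhoP
  inj Du rho_u Kv Du' rho_u' XDv h0 h4 h4s h4Ns b.
(* Both sides are in the kernel of D, so restrictions decide. For a = 0 the factor d is zero. *)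
have wE : twist r2 (left_lower r1 r2 (raised_CK a)) = (d / G) *: raised_CK a.-1.
  have [Dp rho_p _] := CK_spec m1N (@hraised a.-1).
  apply: (lower_rho_inj inj).
    have Dp' : coprod r1 r2 genAm (raised_CK a.-1) = 0 := Dp.
    by rewrite (Dw h1 h2 c12 Du) (opsZ (coprod r1 r2)) Dp' scaler0.
  have rZ x p : rho (x *: p) = x *: rho p by exact: linearZ.
  have rp : rho (raised_CK a.-1) = raised a.-1 := rho_p.
  by rewrite (rho_w h2 G0 rho_r1 rhoK rhoP rho_u) Dv rZ rp scalerA mulrC.
have Q2 : ((- s ^+ 2) ^+ b) ^+ 2 = qpow b%:R ^+ 2.
  by rewrite exprAC sqrrN -exprAC sqrt_qX.
have M0 : M != 0 by exact: qpow_n0.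
have b_ge0 : 0 <= b%:R :> R by rewrite ler0n.
have a_ge0 : 0 <= a%:R :> R by rewrite ler0n.
pose B := raise_coef s g (h a) + iter_coef s g (h a) b * right_raise_coef2 s (h
  a).
have B0 : B != 0.
  (* Squaring removes the sign of (-q)^b. What remains is q^{2(2y + b)} != q^2 and q^{2(2 g3 + b)}
     != 1. *)
  apply: (raise_coef_neq0 s_neq0 s4_neq1 g0 h0 h4s h4Ns).
    rewrite addrC addr_eq0 sqr_neq // exprMn Q2 sqrrN h4E (qpow2 y) sqrt_q
      -exprMn.
    by rewrite -qpowD qpow_sqr_neq // gt_eqF //; lra.
  rewrite sqr_neq // exprMn Q2 (qpow2 g3) expr1n -exprMn -qpowD qpow_sqr //
    gt_eqF //.
  by lra.
pose C := iter_coef s g (h a) b * right_raise_coef0 s G (h a) d.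
have g1 : 1 < gamma_sum mu m.+1 + S%:R + gam (I m.+1).
  have gm := gamma_sum_ge (leqW m1N).
  have E : m.+1%:R = m%:R + 1 :> R by rewrite natr1.
  have := mu_gt0 (I m.+1); have := ler0n R m; have := ler0n R S.
  by rewrite /gamma; lra.
have C0 : (0 < b)%N -> C != 0.
  move=> b_gt0; have bR : 0 < b%:R :> R by rewrite ltr0n.
  apply: mulf_neq0.
    apply: (iter_coef_neq0 s_neq0 s4_neq1 g0).
      by rewrite sqr_neq // Q2 expr1n qpow_sqr // gt_eqF.
    rewrite h4E (qpow2 g3) (qpow2 y) -qpowD sqr_neq // exprMn Q2 sqrrN sqrt_q
      -exprMn -qpowD.
    by rewrite qpow_sqr_neq // gt_eqF //; lra.
  apply: (right_raise_coef0_neq0_lowest s_neq0 s4_neq1 G0 h4 h4Ns M0 _ (erefl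
    d)).
  - rewrite sqrt_qX /h !qpow2 -!qpowD; congr qpow.
    by rewrite /y (gamma_sumS (j := m.+1)) // natrD; field.
  - rewrite sqrt_qX (exprM G 2 2) /G !(qpow2 (_ / _)) (qpow2 (_ / _ * _))
    -qpowD qpow_sqr //.
    by rewrite gt_eqF // /gamma; have := mu_gt0 (I m.+1); lra.
  rewrite sqrt_qX (exprM G 2 2) /G (qpow2 (_ / _)) (qpow2 (_ / _ * _)) /M
    (qpow2 (_ - _)) -!qpowD qpow_sqr //.
  by rewrite gt_eqF //; lra.
have d_neq0 : (0 < a)%N -> d != 0.
  move=> a_gt0; have aR : 0 < a%:R :> R by rewrite ltr0n.
  rewrite /d (lowest_coef_neq0 s_neq0 s4_neq1 M0) // sqrt_qX;
    first by rewrite qpow_sqr // gt_eqF.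
  rewrite /M qpow2 -qpowD qpow_sqr // gt_eqF //.
  have gm := gamma_sum_ge (leqW m1N).
  have E : m.+1%:R = m%:R + 1 :> R by rewrite natr1.
  by have := ler0n R m; have := ler0n R S; lra.
exists (B * (d / G)), A, C; split => //.
  move=> a_gt0; apply: mulf_neq0 => //; apply: mulf_neq0; first exact: d_neq0.
  by rewrite invr_neq0.
have {}EA : reduced_casimir s r1 r2 g
      (iter b (head_ops m.+2 genAp) (raised_CK a)) =
  B *: iter b.+1 (head_ops m.+2 genAp) (twist r2 (left_lower r1 r2 (raised_CK a))) +
  A *: iter b (head_ops m.+2 genAp) (raised_CK a) +
  C *: iter b.-1 (head_ops m.+2 genAp) (raised_CK a.+1) := EA.
have wX : iter b.+1 (head_ops m.+2 genAp) ((d / G) *: raised_CK a.-1) =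
    (d / G) *: iter b.+1 (head_ops m.+2 genAp) (raised_CK a.-1).
  exact: iter_scale.
rewrite EA wE wX scalerA; congr (_ *: _ + _ + _ *: _).
  by case: (a) d0 => [/(_ erefl) ->|//]; rewrite mul0r mulr0.
case: posnP => // b0.
by rewrite /C b0 /iter_coef expr0 subrr !mul0r.
Qed.

End LowestVector.

Definition casimir_mid : {linear VPol -> VPol} := casimir_op s r23.

Lemma casimir_mid_comm (f : {linear VPol -> VPol}) :
  (forall g p, f (r2 g p) = r2 g (f p)) -> (forall g p,
    f (r3 g p) = r3 g (f p)) ->
  forall p, f (casimir_mid p) = casimir_mid (f p).
Proof. by move=> f2 f3; apply: casimir_comm; apply: coprod_comm. Qed.

Lemma casimir_mid_var j g p : (m.+2 < j)%N -> (j <= n)%N ->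
  casimir_mid (var_ops (I j) g p) = var_ops (I j) g (casimir_mid p).
Proof.
move=> mj jn; apply/esym/(casimir_mid_comm (f := var_ops (I j) g)) => h u.
  by apply: var_commuting; apply: Ineq => //; exact: ltnW.
by apply: var_commuting; apply: Ineq.
Qed.

Lemma casimir_mid_slice j p : (m.+2 < j)%N -> (j <= n)%N ->
  slice (I j) 0 (casimir_mid p) = casimir_mid (slice (I j) 0 p).
Proof.
move=> mj jn; apply: (casimir_mid_comm (f := slice (I j) 0)) => h u.
  by apply: slice_var; apply: Ineq => //; exact: ltnW.
by apply: slice_var; apply: Ineq.
Qed.

(** For the smallest such j, coassociativity groups the two factors of the Casimir operator into
    one, where it is central; further factors commute with it. *)
Lemma casimir_mid_head j g p : (m.+2 < j)%N -> (j <= n.+1)%N ->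
  casimir_mid (head_ops j g p) = head_ops j g (casimir_mid p).
Proof.
elim: j g p => // j IH g p; rewrite ltnS leq_eqVlt => /predU1P[<-|mj] jn.
  have E u : head_ops m.+3 g u = coprod r1 r23 g u by exact: (coprodA c12 c23
    h2 g u).
  rewrite !E; apply: coprod_comm => {g p E} g p.
    apply/esym/(casimir_mid_comm (f := r1 g)) => h u; first by rewrite c12.
    by rewrite c13.
  exact: (casimir_central s_neq0 s4_neq1 (coprod_osp s_neq0 s4_neq1 h2 h3 c23)
    g p).
apply: (coprod_comm (f := casimir_mid)) => h u; first by apply: IH;
  rewrite // ltnW.
exact: casimir_mid_var.
Qed.

Definition shifted (t t' : seq nat) (a b : nat) :=
  [/\ nth 0%N t' m = a, nth 0%N t' m.+1 = b &
    forall l, (l < n)%N -> l != m -> l != m.+1 -> nth 0%N t' l = nth 0%N t l].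

(** Under this condition every CK and X applied after the pair has the same degree and the same
    power for both sequences. *)
Definition compatible (t t' : seq nat) :=
  [/\ (forall l, (l < m)%N -> nth 0%N t' l = nth 0%N t l),
      (nth 0%N t' m + nth 0%N t' m.+1 = nth 0%N t m + nth 0%N t m.+1)%N &
      forall l, (m.+1 < l < n)%N -> nth 0%N t' l = nth 0%N t l].

Lemma shifted_compatible t t' a b : shifted t t' a b ->
  (a + b = nth 0%N t m + nth 0%N t m.+1)%N -> compatible t t'.
Proof.
by case=> sa sb E ab; split; rewrite ?sa ?sb // => l hl; apply: E; lia.
Qed.

Lemma compatible_sum t t' i : compatible t t' -> (m.+2 <= i <= n)%N ->
  (\sum_(l < i) nth 0%N t' l = \sum_(l < i) nth 0%N t l)%N.
Proof.
case=> E1 E2 E3; elim: i => // i IH /andP[mi iN].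
rewrite big_ord_recr [RHS]big_ord_recr /=.
move: mi; rewrite leq_eqVlt => /predU1P[[<-]|mi].
  rewrite big_ord_recr [in RHS]big_ord_recr /= -!addnA E2; congr (_ + _)%N.
  by apply: eq_bigr => l _; rewrite E1.
by rewrite IH ?E3 //; lia.
Qed.

(** The constants are chosen before i: they arise at i = m+2 and are carried unchanged through all
    later extensions. *)
Lemma partial_psi_three_term t : let a := nth 0%N t m in let b := nth 0%N t
  m.+1 in
  exists B A C, [/\ (0 < a)%N -> B != 0, (0 < b)%N -> C != 0 &
    forall tm tp, ((0 < a)%N -> shifted t tm a.-1 b.+1) ->
      ((0 < b)%N -> shifted t tp a.+1 b.-1) ->
      forall i, (m.+2 <= i <= n)%N -> casimir_mid (partial_psi t i) =
        (if (0 < a)%N then B else 0) *: partial_psi tm i + A *: partial_psi t i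
        + (if (0 < b)%N then C else 0) *: partial_psi tp i].
Proof.
move=> a b; set S := (\sum_(l < m) nth 0%N t l)%N.
have [hphi Dphi] := partial_psi_spec t (ltnW m1N).
have g3_gt0 : 0 < gam (I m.+2) by rewrite /gamma; have := mu_gt0 (I m.+2); lra.
have [B [A [C [B0 C0 E]]]] := local_three_term hphi Dphi a b g3_gt0.
exists B, A, C; split=> // tm tp htm htp.
set B' := (if _ then B else 0); set C' := (if _ then C else 0).
(* If a or b is 0, the corresponding sequence is unconstrained but has coefficient 0; t then
   replaces it, so that the degree conditions hold throughout. *)
pose um := if (0 < a)%N then tm else t; pose up := if (0 < b)%N then tp else t.
have cm : compatible t um.
  rewrite /um; case: posnP => [_|a0]; first by split.
  by apply: (shifted_compatible (htm a0)); rewrite -/a -/b; lia.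
have cp : compatible t up.
  rewrite /up; case: posnP => [_|b0]; first by split.
  by apply: (shifted_compatible (htp b0)); rewrite -/a -/b; lia.
suff main : forall i, (m.+2 <= i <= n)%N -> casimir_mid (partial_psi t i) =
    B' *: partial_psi um i + A *: partial_psi t i + C' *: partial_psi up i.
  move=> i hi; rewrite main // /B' /C' /um /up.
  by case: posnP => _; case: posnP => _; rewrite ?scale0r.
move=> i /andP[mi]; rewrite -(subnKC mi); move: (i - m.+2)%N => e {i mi}.
have hyp u i : compatible t u -> (m.+2 <= i)%N -> (i < n)%N ->
    hpoly i.+1 (\sum_(l < i.+1) nth 0%N t l)%N
      (iter (nth 0%N t i) (head_ops i.+1 genAp) (partial_psi u i)).
  move=> cu mi iN; rewrite big_ord_recr -(compatible_sum cu) ?mi ?(ltnW iN) //.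
  have [hu _] := partial_psi_spec u (ltnW iN).
  exact: (hpoly_iter_raise (leqnn _) (leqW iN) hu).
have psiE u i : compatible t u -> (m.+2 <= i)%N -> (i < n)%N -> partial_psi u
  i.+1 =
    CK (I i.+1) (\sum_(l < i.+1) nth 0%N t l)%N
      (iter (nth 0%N t i) (head_ops i.+1 genAp) (partial_psi u i)).
  move=> cu mi iN; rewrite partial_psiS (compatible_sum cu) ?iN ?(leqW mi) //.
  by case: cu => _ _ -> //; rewrite iN andbT.
have ct : compatible t t by split.
elim: e => [|e IH] eN; last first.
  move: eN IH; rewrite addnS; move: (m.+2 + e)%N (leq_addr e m.+2) => i mi iN
    IH.
  rewrite !psiE //; apply: CK_three_term => //; try exact: hyp.
    by move=> p; apply: casimir_mid_head; lia.
  rewrite casimir_mid_slice //.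
  have [_ S1 _] := CK_spec iN (hyp t i ct mi iN).
  rewrite S1; have Git c u : casimir_mid (iter c (head_ops i.+1 genAp) u) =
      iter c (head_ops i.+1 genAp) (casimir_mid u).
    by elim: c => // c IHc; rewrite !iterS casimir_mid_head ?IHc // ltnW.
  by rewrite Git IH ?(ltnW iN) // iter_linear3.
rewrite addn0 in eN *.
have hyp2 u : compatible t u -> hpoly m.+2 (\sum_(l < m.+2) nth 0%N t l)%N
    (iter (nth 0%N u m.+1) (head_ops m.+2 genAp) (partial_psi u m.+1)).
  move=> cu; rewrite -(compatible_sum cu) ?leqnn // big_ord_recr.
  have [hu _] := partial_psi_spec u m1N.
  exact: (hpoly_iter_raise (leqnn _) (leqW mN) hu).
have psiE2 u : compatible t u -> partial_psi u m.+2 =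
    CK (I m.+2) (\sum_(l < m.+2) nth 0%N t l)%N
      (iter (nth 0%N u m.+1) (head_ops m.+2 genAp) (partial_psi u m.+1)).
  by move=> cu; rewrite partial_psiS (compatible_sum cu) ?leqnn.
have partial_raised u : compatible t u ->
    partial_psi u m.+1 = raised_CK (partial_psi t m) S (nth 0%N u m).
  move=> [E1 _ _]; rewrite partial_psiS big_ord_recr /= (partial_psi_ext E1)
    /raised_CK.
  by congr (CK _ (_ + _)%N _); apply: eq_bigr => l _; rewrite E1.
rewrite !psiE2 //; apply: CK_three_term => //; try exact: hyp2.
  by move=> p; apply: casimir_mid_head.
have [D0 S1 _] := CK_spec mN (hyp2 t ct).
pose rho : {linear VPol -> VPol} := slice (I m.+2) 0.
have rho_r1 (x : osp_gen) (p : Pol) : rho (r1 x p) = r1 x (rho p).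
  by apply: slice_head; rewrite Iv // leqW.
have rho_r2 (x : osp_gen) (p : Pol) : rho (r2 x p) = r2 x (rho p).
  by apply: slice_var; apply: Ineq.
have rhoX (p : Pol) : rho (r3 genAp p) = 0 by exact: slice_X0.
have rhoK (p : Pol) : rho (r3 genK p) = qpow (gam (I m.+2) / 2) *: rho p.
  by rewrite [LHS]slice_K mulr1.
have rhoP (p : Pol) : rho (r3 genP p) = rho p by rewrite [LHS]slice_P scale1r.
have GG : qpow (gam (I m.+2) / 2) ^+ 2 = qpow (gam (I m.+2)).
  by rewrite expr2 -qpowD; congr qpow; field.
(* In the base case the restriction to the last variable of the pair turns the Casimir operator into
   the reduced one. *)
transitivity (reduced_casimir s r1 r2 (qpow (gam (I m.+2)))
    (iter b (head_ops m.+2 genAp) (partial_psi t m.+1))).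
  have := rho_casimir s_neq0 s4_neq1 h1 h2 h3 c12 c23 (qpow_n0 _)
    rho_r1 rho_r2 rhoX rhoK rhoP D0.
  by rewrite GG => ->; congr (reduced_casimir _ _ _ _ _); exact: S1.
rewrite (partial_raised t) // E (partial_raised um) // (partial_raised up) //;
  congr (_ + _ + _).
  rewrite /B' /um; case: posnP => [_|a0]; first by rewrite !scale0r.
  by have [-> -> _] := htm a0.
rewrite /C' /up; case: posnP => [_|b0]; first by rewrite !scale0r.
by have [-> -> _] := htp b0.
Qed.

End Pair.

(** * From operators and exponent sequences to the tensor algebra and allowable vectors *)

Lemma act_casimir_pair m (p : Pol) :
  act (V := Pol) real (casimir_pair q qpow n m.+2) p = casimir_mid m p.
Proof.
(* The indices stay sums, as in [casimir_pair], so that the action unfolds to this form by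
   conversion. *)
pose r := coprod (var_ops (I (m.+1 + 0))) (var_ops (I (m.+1 + 1))).
have -> : act (V := Pol) real (casimir_pair q qpow n m.+2) p =
    (-1) *: r genAp (r genAm (r genP p))
    + ((qpow (- 2^-1) / (q - q^-1)) *: r genK (r genK (r genP p))
       + (-1) *: ((s / (q - q^-1)) *: r genKinv (r genKinv (r genP p)))).
  by [].
rewrite {}/r addn0 addn1 -[RHS]/(casimir_op s (coprod _ _) p).
rewrite /casimir_op !scaleN1r addrA.
by rewrite qpow_N -q_sqrt.
Qed.

Definition exponents (j : 'rV[int]_n) : seq nat :=
  [seq `|j ord0 l|%N | l <- enum 'I_n].

Lemma nth_exponents j (l : 'I_n) : nth 0%N (exponents j) l = `|j ord0 l|%N.
Proof.
by rewrite (nth_map l) ?nth_ord_enum ?size_enum_ord ?ltn_ord.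
Qed.

Lemma psiE k j : (0 < n)%N -> psi q qpow mu k j =
  if allowable k j then partial_psi (exponents j) n else 0.
Proof.
move=> n0; rewrite /psi; case: ifP => // _.
by rewrite psi_recE ?prednK.
Qed.

Lemma sum_hvec m : (m.+2 <= n)%N -> \sum_l hvec n m.+2 ord0 l = 0.
Proof.
move=> mN; have m0 : (m < n)%N := ltnW mN.
rewrite (bigD1 (Ordinal m0)) //= (bigD1 (Ordinal mN)) /=; last first.
  by rewrite -val_eqE /= gtn_eqF.
rewrite !mxE /= eqxx (negPf (_ : m.+3 != m.+2)) ?eqxx; last by rewrite gtn_eqF.
rewrite big1 => [|l /andP[]]; first by rewrite addr0 subrr.
rewrite -!val_eqE /= => /negPf l1 /negPf l2.
by rewrite mxE !eqSS l1 l2.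
Qed.

(** The total is preserved, so only the entry c that decreases can spoil allowability. The boolean
    selects the sign, which lets both shifts share the argument. *)
Lemma exponent_shift (e : bool) k m j (m0 : (m < n)%N) (mN : (m.+1 < n)%N) :
  allowable k j ->
  let j' := if e then j - hvec n m.+2 else j + hvec n m.+2 in
  let a := nth 0%N (exponents j) m in let b := nth 0%N (exponents j) m.+1 in
  let c := if e then a else b in
  allowable k j' = (0 < c)%N /\
  ((0 < c)%N -> shifted m (exponents j) (exponents j')
    (if e then a.-1 else a.+1) (if e then b.+1 else b.-1)).
Proof.
move=> /andP[/forallP jge /eqP jsum] j' a b c.
have jE l : j' ord0 l = j ord0 l + (if e then -1 else 1) * hvec n m.+2 ord0 l.
  by rewrite /j'; case: (e); rewrite !mxE ?mulN1r ?mul1r.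
have hE l : hvec n m.+2 ord0 l =
    if l == m :> nat then 1 else if l == m.+1 :> nat then -1 else 0.
  by rewrite mxE !eqSS.
have ja : j ord0 (Ordinal m0) = a%:Z.
  by rewrite /a -[m]/(val (Ordinal m0)) nth_exponents gez0_abs.
have jb : j ord0 (Ordinal mN) = b%:Z.
  by rewrite /b -[m.+1]/(val (Ordinal mN)) nth_exponents gez0_abs.
have ja' : j' ord0 (Ordinal m0) = a%:Z + (if e then -1 else 1).
  by rewrite jE hE /= eqxx mulr1 ja.
have jb' : j' ord0 (Ordinal mN) = b%:Z - (if e then -1 else 1).
  by rewrite jE hE /= eqxx gtn_eqF // mulrN1 jb.
have jl' (l : 'I_n) : l != m :> nat -> l != m.+1 :> nat -> j' ord0 l = j ord0 l.
  by move=> /negPf lm /negPf lm1; rewrite jE hE lm lm1 mulr0 addr0.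
have sum' : \sum_l j' ord0 l = k%:Z.
  rewrite (eq_bigr _ (fun l _ => jE l)) big_split /= jsum -mulr_sumr.
  by rewrite sum_hvec // mulr0 addr0.
split.
  rewrite /allowable sum' eqxx andbT.
  apply/forallP/idP => [j'ge|c0 l].
    by move: (j'ge (Ordinal m0)) (j'ge (Ordinal mN)); rewrite ja' jb' /c;
      case: (e); lia.
  have [lm|lm] := eqVneq (l : nat) m.
    rewrite (_ : l = Ordinal m0) ?ja'; last exact: val_inj.
    by move: c0; rewrite /c; case: (e); lia.
  have [lm1|lm1] := eqVneq (l : nat) m.+1.
    rewrite (_ : l = Ordinal mN) ?jb'; last exact: val_inj.
    by move: c0; rewrite /c; case: (e); lia.
  by rewrite jl'.
move=> c0; split.
- rewrite -[m in LHS]/(val (Ordinal m0)) nth_exponents ja'.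
  by move: c0; rewrite /c; case: (e); lia.
- rewrite -[m.+1 in LHS]/(val (Ordinal mN)) nth_exponents jb'.
  by move: c0; rewrite /c; case: (e); lia.
move=> l ln lm lm1; rewrite -[l]/(val (Ordinal ln)) !nth_exponents.
by rewrite jl'.
Qed.

Theorem psi_three_term k m (j : 'rV[int]_n) : (m.+2 <= n)%N -> allowable k j ->
  exists B A C,
  [/\ act (V := Pol) real (casimir_pair q qpow n m.+2) (psi q qpow mu k j) =
      B *: psi q qpow mu k (j - hvec n m.+2) + A *: psi q qpow mu k j
      + C *: psi q qpow mu k (j + hvec n m.+2),
    allowable k (j - hvec n m.+2) -> B != 0 &
    allowable k (j + hvec n m.+2) -> C != 0].
Proof.
move=> mN jk; have n0 : (0 < n)%N by exact: leq_ltn_trans mN.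
have [am hm] := exponent_shift true (ltnW mN) mN jk.
have [ap hp] := exponent_shift false (ltnW mN) mN jk.
have [B [A [C [B0 C0 E]]]] := partial_psi_three_term mN (exponents j).
exists B, A, C; split; last 2 first.
- by rewrite am.
- by rewrite ap.
rewrite act_casimir_pair !psiE // jk am ap (E _ _ hm hp) ?leqnn ?mN //.
congr (_ + _ + _).
  by case: ifP; rewrite ?scale0r ?scaler0.
by case: ifP; rewrite ?scale0r ?scaler0.
Qed.

End Polynomials.

(** As |exp z| = exp (Re z), the modulus of q^{2a} is exp (2 a Re ell), and |q| != 1 means Re ell !=
    0. *)
Lemma cpow_sqr_neq1 (R : realType) (q ell : R[i]) (a : R) :
  `|q| != 1 -> cexp ell = q -> a != 0 -> cpow ell a ^+ 2 != 1.
Proof.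
move=> q1 ellq a0; have cexp_norm (z : R[i]) : `|cexp z| = (sequences.expR
  (complex.Re z))%:C.
  case: z => x y; rewrite /ComplexExp.cexp normrM /=.
  rewrite ger0_norm ?lecR ?exp.expR_ge0 // -[RHS]mulr1; congr (_ * _).
  by rewrite normc_def /= trigo.cos2Dsin2 sqrtr1.
have re0 : complex.Re ell != 0.
  by apply: contra q1 => /eqP E; rewrite -ellq cexp_norm E exp.expR0.
have -> : cpow ell a ^+ 2 = cexp ((a *+ 2)%:C * ell).
  by rewrite expr2 -cpowD.
apply/eqP => /(congr1 Num.norm); rewrite cexp_norm normr1 => /(congr1
  (@complex.Re R)) /=.
rewrite -[1]exp.expR0 => /exp.expR_inj /eqP.
case: ell {ellq q1} re0 => x y /= re0.
by rewrite mul0r subr0 mulf_eq0 (negPf re0) orbF mulrn_eq0 (negPf a0).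
Qed.

Theorem theorem2 (R : realType) (n k m : nat) (hn : (3 <= n.+1)%N)
    (hm : (2 <= m <= n)%N) (q ell : R[i]) (hq0 : q != 0) (hq1 : `|q| != 1)
    (hell : cexp ell = q) (mu : 'I_n.+1 -> R) (hmu : forall i, 0 < mu i) :
  exists A B C : 'rV[int]_n -> R[i],
    (forall j : 'rV[int]_n, allowable k j ->
       act (realization q (cpow ell) mu) (casimir_pair q (cpow ell) n m)
           (psi q (cpow ell) mu k j)
       = B j *: psi q (cpow ell) mu k (j - hvec n m)
         + A j *: psi q (cpow ell) mu k j
         + C j *: psi q (cpow ell) mu k (j + hvec n m))
    /\ (forall j : 'rV[int]_n, allowable k j -> allowable k (j - hvec n m) ->
          B j != 0)
    /\ (forall j : 'rV[int]_n, allowable k j -> allowable k (j + hvec n m) ->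
          C j != 0).
Proof.
case: m hm => [|[|m]] // hm.
have qpow1 : cpow ell 1 = q by rewrite cpow1.
(* Default constants 0 for vectors that are not allowable make existence total in j, as choice
   requires. *)
have three j : exists BAC : R[i] * R[i] * R[i], allowable k j ->
    [/\ act (realization q (cpow ell) mu) (casimir_pair q (cpow ell) n m.+2)
          (psi q (cpow ell) mu k j)
        = BAC.1.1 *: psi q (cpow ell) mu k (j - hvec n m.+2)
          + BAC.1.2 *: psi q (cpow ell) mu k j
          + BAC.2 *: psi q (cpow ell) mu k (j + hvec n m.+2),
      allowable k (j - hvec n m.+2) -> BAC.1.1 != 0 &
      allowable k (j + hvec n m.+2) -> BAC.2 != 0].
  have [jk|_] := boolP (allowable k j); last by exists (0, 0, 0).
  have [B [A [C E]]] := psi_three_term (cpowD ell) qpow1 hq0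
    (fun a => @cpow_sqr_neq1 R q ell a hq1 hell) hmu hm jk.
  by exists (B, A, C).
have [f E] := boolp.choice three.
exists (fun j => (f j).1.2), (fun j => (f j).1.1), (fun j => (f j).2).
by split; [|split] => j jk; case: (E j jk).
Qed.
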